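(* Let $\alpha$ be a complex parameter in the modular strip. The non-genuine crystallographic complex reflection groups $[G(2,1,n)]_1^\alpha$ ($n\ge 1$) and $[W(A_{n-1})]^\alpha$ ($n\ge 2$) have the following presentations, whose generators $\sigma_i$ are reflections of the group. (i) $$[G(2,1,1)]_1^\alpha\simeq[W(A_1)]^\alpha\simeq\langle \sigma_1,\sigma_2,\sigma_3\mid \sigma_1^2=\sigma_2^2=\sigma_3^2=(\sigma_1\sigma_2\sigma_3)^2=1\rangle.$$ (ii) For $n\ge 2$, $[G(2,1,n)]_1^\alpha$ is isomorphic to the group with generators $\sigma_1,\dots,\sigma_{n+2}$ and relations - $\sigma_1^2=\dots=\sigma_{n+2}^2=1$ and $(\sigma_1\sigma_2\cdots\sigma_{n+2}\,\sigma_n\sigma_{n-1}\cdots\sigma_2)^2=1$; - $\sigma_i\sigma_j=\sigma_j\sigma_i$ for $1\le i,j\le n$ with $|i-j|>1$, and for $i\in\{n+1,n+2\}$, $1\le j\le n-1$; - $\sigma_i\sigma_j\sigma_i=\sigma_j\sigma_i\sigma_j$ for $2\le i,j\le n$ with $i-j=1$; - $\sigma_i\sigma_j\sigma_i\sigma_j=\sigma_j\sigma_i\sigma_j\sigma_i$ for $(i,j)=(1,2)$, and for $i\in\{n+1,n+2\}$, $j=n$; - $\sigma_n\sigma_{n+1}\sigma_n^{-1}\sigma_{n+2}=\sigma_{n+2}\sigma_n\sigma_{n+1}\sigma_n^{-1}$. (iii) For $n\ge 3$, $[W(A_{n-1})]^\alpha$ is isomorphic to the group with generators $\sigma_1,\dots,\sigma_{n+1}$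 and relations - $\sigma_1^2=\dots=\sigma_{n+1}^2=1$ and $(\sigma_1\sigma_2\cdots\sigma_{n+1}\,\sigma_{n-1}\sigma_{n-2}\cdots\sigma_2)^2=1$; - $\sigma_i\sigma_j=\sigma_j\sigma_i$ for $1\le i,j\le n-1$ with $|i-j|>1$, and for $i\in\{n,n+1\}$, $2\le j\le n-2$; - $\sigma_i\sigma_j\sigma_i=\sigma_j\sigma_i\sigma_j$ for $1\le i,j\le n-1$ with $i-j=1$, and for $i\in\{n,n+1\}$, $j\in\{1,n-1\}$; - $\sigma_{n+1}\sigma_{n-1}\sigma_{n-2}\cdots\sigma_1\sigma_n\sigma_1^{-1}=\sigma_{n-1}\sigma_n^{-1}\sigma_{n-1}^{-1}\sigma_{n-2}^{-1}\cdots\sigma_1^{-1}\sigma_{n+1}^{-1}$.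
   Context: The modular strip is the standard fundamental domain of $SL_2(\mathbb Z)$ acting on the upper half-plane, so in particular $\operatorname{Im}\alpha>0$. Put $\Lambda_\alpha=\mathbb Z+\alpha\mathbb Z\subset\mathbb C$. $[G(2,1,n)]_1^\alpha$ ($n\ge1$) is the group of affine transformations $z\mapsto gz+t$ of $\mathbb C^n$ with $g\in G(2,1,n)$ (the group of signed $n\times n$ permutation matrices, i.e. the Weyl group $W(C_n)$) and $t\in\Lambda_\alpha^n$. $[W(A_{n-1})]^\alpha$ ($n\ge2$) is the group of affine transformations $z\mapsto gz+t$ of $V=\{z\in\mathbb C^n: z_1+\dots+z_n=0\}$ with $g\in\mathfrak S_n$ (acting by permutation of coordinates) and $t\in\Lambda_\alpha^n\cap V$. The group law is composition. A reflection is a non-identity affine transformation of finite order fixing pointwise a complex affine hyperplane. *)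

(* Defs.v *)
From HB Require Import structures.
From mathcomp Require Import all_boot all_order all_fingroup all_algebra.
From mathcomp Require Import boolp reals complex.

Set Implicit Arguments.
Unset Strict Implicit.
Unset Printing Implicit Defensive.

Import GRing.Theory Num.Theory.

Local Open Scope ring_scope.

(* A letter (i, b) of a word in k generators is the i-th generator if b is
   false, and its inverse if b is true; words need not be reduced. *)
Definition word (k : nat) := seq ('I_k * bool).

Declare Scope word_scope.
Delimit Scope word_scope with W.
Bind Scope word_scope with word.

Section Words.
Variable k : nat.

Definition wone : word k := [::].
Definition wmul (u v : word k) : word k := u ++ v.
Definition winv (u : word k) : word k := rev [seq (x.1, ~~ x.2) | x <- u].
Definition wexp (u : word k) (m : nat) : word k := iter m (wmul u) wone.
Definition wprod (s : seq nat) (F : nat -> word k) : word k :=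
  foldr (fun i => wmul (F i)) wone s.

End Words.

Arguments wone {k}.

Notation "1" := wone : word_scope.
Notation "u * v" := (wmul u v) : word_scope.
Notation "u ^-1" := (winv u) : word_scope.
Notation "u ^+ m" := (wexp u m) : word_scope.
Notation "\prod_ ( i <- s ) F" := (wprod s (fun i => F%W)) : word_scope.

Section Presentation.
Variables (k : nat) (rels : word k -> word k -> Prop).

(* The least congruence that contains the relations u = v with rels u v and
   makes each letter inverse to its opposite; it is automatically compatible
   with winv. *)
Inductive wcong : word k -> word k -> Prop :=
| wcong_refl u : wcong u u
| wcong_sym u v : wcong u v -> wcong v u
| wcong_trans v u w : wcong u v -> wcong v w -> wcong u w
| wcong_mul u u' v v' : wcong u u' -> wcong v v' -> wcong (u * v)%W (u' * v')%W
| wcong_cancel i b : wcong [:: (i, b); (i, ~~ b)] 1%W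
| wcong_rel u v : rels u v -> wcong u v.

Definition wcongb : rel (word k) := fun u v => `[< wcong u v >].

Lemma wcongb_refl : reflexive wcongb.
Proof. by move=> u; apply/asboolP; apply: wcong_refl. Qed.

Lemma wcongb_sym : symmetric wcongb.
Proof. by move=> u v; apply/asboolP/asboolP; apply: wcong_sym. Qed.

Lemma wcongb_trans : transitive wcongb.
Proof.
move=> v u w /asboolP uv /asboolP vw; apply/asboolP.
exact: wcong_trans uv vw.
Qed.

Canonical wcong_equiv := EquivRel wcongb wcongb_refl wcongb_sym wcongb_trans.

Definition presented := {eq_quot wcong_equiv}%qT.
HB.instance Definition _ := Choice.on presented.
HB.instance Definition _ := EqQuotient.on presented.

Definition pclass (u : word k) : presented := \pi_presented%qT u.
Definition prepr (x : presented) : word k := generic_quotient.repr x.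

Lemma preprK : cancel prepr pclass.
Proof. by move=> x; rewrite /pclass /prepr reprK. Qed.

Lemma pclassP u v : pclass u = pclass v <-> wcong u v.
Proof.
split; first by move/eqquotP => /asboolP.
by move=> uv; apply/eqquotP/asboolP.
Qed.

Lemma wcong_prepr u : wcong (prepr (pclass u)) u.
Proof. by apply/pclassP; rewrite preprK. Qed.

Lemma winv_cons x (u : word k) : (winv (x :: u) = winv u * [:: (x.1, ~~ x.2)])%W.
Proof. by rewrite /winv /= rev_cons -cats1. Qed.

Lemma winvK : involutive (@winv k).
Proof.
move=> u; rewrite /winv map_rev revK -map_comp.
by elim: u => //= [[i b] u ->] /=; rewrite negbK.
Qed.

Lemma wcong_mulwV u : wcong (u * u^-1)%W 1%W.
Proof.
elim: u => [|[i b] u IHu]; first exact: wcong_refl.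
have -> : (((i, b) :: u) * ((i, b) :: u)^-1 =
    [:: (i, b)] * (u * u^-1 * [:: (i, ~~ b)]))%W.
  by rewrite winv_cons /wmul /= catA.
apply: wcong_trans (wcong_cancel i b).
exact: (wcong_mul (wcong_refl [:: (i, b)])
          (wcong_mul IHu (wcong_refl [:: (i, ~~ b)]))).
Qed.

Lemma wcong_mulVw u : wcong (u^-1 * u)%W 1%W.
Proof. by rewrite -{2}[u]winvK; apply: wcong_mulwV. Qed.

Lemma wcong_inv u v : wcong u v -> wcong (u^-1)%W (v^-1)%W.
Proof.
move=> uv; apply: (@wcong_trans (u^-1 * (v * v^-1))%W).
  rewrite -{1}[(u^-1)%W]cats0; apply: wcong_mul; first exact: wcong_refl.
  exact/wcong_sym/wcong_mulwV.
rewrite /wmul catA -[X in wcong _ X]cat0s.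
apply: (@wcong_mul _ 1%W); last exact: wcong_refl.
apply: wcong_trans (wcong_mulVw u).
by apply: wcong_mul; [apply: wcong_refl | apply: wcong_sym].
Qed.

Definition pmul (x y : presented) := pclass (prepr x * prepr y)%W.
Definition pinv (x : presented) := pclass ((prepr x)^-1)%W.

Lemma pmulE u v : pmul (pclass u) (pclass v) = pclass (u * v)%W.
Proof. by apply/pclassP; apply: wcong_mul; apply: wcong_prepr. Qed.

Lemma pinvE u : pinv (pclass u) = pclass (u^-1)%W.
Proof. by apply/pclassP; apply/wcong_inv/wcong_prepr. Qed.

Lemma pmulA : associative pmul.
Proof.
move=> x y z; rewrite -[x]preprK -[y]preprK -[z]preprK !pmulE.
by rewrite /wmul catA.
Qed.

Lemma pmul1g : left_id (pclass 1%W) pmul.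
Proof. by move=> x; rewrite -[x]preprK pmulE. Qed.

Lemma pmulg1 : right_id (pclass 1%W) pmul.
Proof. by move=> x; rewrite -[x]preprK pmulE /wmul cats0. Qed.

Lemma pmulVg : left_inverse (pclass 1%W) pinv pmul.
Proof.
move=> x; rewrite -[x]preprK pinvE pmulE.
by apply/pclassP; apply: wcong_mulVw.
Qed.

Lemma pmulgV : right_inverse (pclass 1%W) pinv pmul.
Proof.
move=> x; rewrite -[x]preprK pinvE pmulE.
by apply/pclassP; apply: wcong_mulwV.
Qed.

HB.instance Definition _ :=
  isGroup.Build presented pmulA pmul1g pmulg1 pmulVg pmulgV.

Definition pgen (i : 'I_k) : presented := pclass [:: (i, false)].

End Presentation.

Definition isomorphic (G H : groupType) : Prop :=
  exists phi : {multiplicative G -> H}, bijective phi.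

Section Affine.
Variables (K : fieldType) (E : vectType K).

(* (g, t) stands for z |-> g z + t, with g invertible *)
Definition affine := {p : 'End(E) * E | lker p.1 == 0%VS}.
HB.instance Definition _ := [Choice of affine by <:].

Implicit Types f h : affine.

Definition aff_fun f (z : E) : E := (val f).1 z + (val f).2.

Lemma aff_funP f h : aff_fun f =1 aff_fun h -> f = h.
Proof.
case: f h => [[g t] gP] [[g' t'] gP'] eqfh; apply: val_inj => /=.
have tE : t = t' by have := eqfh 0; rewrite /aff_fun /= !linear0 !add0r.
rewrite -tE; congr (_, _); apply/lfunP => z.
by have := eqfh z; rewrite /aff_fun /= -tE => /addIr.
Qed.

Fact aff_one_subproof : lker (\1%VF : 'End(E)) == 0%VS.
Proof. by apply/lker0P => u v; rewrite !id_lfunE. Qed.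
Definition aff_one : affine := exist _ (\1%VF, 0) aff_one_subproof.

Fact aff_mul_subproof f h : lker ((val f).1 \o (val h).1)%VF == 0%VS.
Proof.
have /lker0P fP := valP f; have /lker0P hP := valP h.
by apply/lker0P => u v; rewrite !comp_lfunE => /fP/hP.
Qed.
Definition aff_mul f h : affine :=
  exist _ (((val f).1 \o (val h).1)%VF, (val f).1 (val h).2 + (val f).2)
    (aff_mul_subproof f h).

Fact aff_inv_subproof f : lker ((val f).1^-1)%VF == 0%VS.
Proof. by apply/lker0P; apply: (can_inj (lker0_lfunVK (valP f))). Qed.
Definition aff_inv f : affine :=
  exist _ (((val f).1^-1)%VF, - ((val f).1^-1)%VF (val f).2)
    (aff_inv_subproof f).

Lemma aff_oneE z : aff_fun aff_one z = z.
Proof. by rewrite /aff_fun /= id_lfunE addr0. Qed.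

Lemma aff_mulE f h z : aff_fun (aff_mul f h) z = aff_fun f (aff_fun h z).
Proof. by rewrite /aff_fun /= comp_lfunE linearD addrA. Qed.

Lemma aff_funK f : cancel (aff_fun f) (aff_fun (aff_inv f)).
Proof.
move=> z; rewrite /aff_fun /= linearD /= addrK.
exact: lker0_lfunK (valP f) z.
Qed.

Lemma aff_funVK f : cancel (aff_fun (aff_inv f)) (aff_fun f).
Proof.
move=> z; rewrite /aff_fun /= linearD linearN /=.
by rewrite !(lker0_lfunVK (valP f)) subrK.
Qed.

Lemma aff_mulA : associative aff_mul.
Proof. by move=> f h l; apply: aff_funP => z; rewrite !aff_mulE. Qed.

Lemma aff_mul1g : left_id aff_one aff_mul.
Proof. by move=> f; apply: aff_funP => z; rewrite aff_mulE aff_oneE. Qed.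

Lemma aff_mulg1 : right_id aff_one aff_mul.
Proof. by move=> f; apply: aff_funP => z; rewrite aff_mulE aff_oneE. Qed.

Lemma aff_mulVg : left_inverse aff_one aff_inv aff_mul.
Proof. by move=> f; apply: aff_funP => z; rewrite aff_mulE aff_oneE aff_funK. Qed.

Lemma aff_mulgV : right_inverse aff_one aff_inv aff_mul.
Proof.
by move=> f; apply: aff_funP => z; rewrite aff_mulE aff_oneE aff_funVK.
Qed.

HB.instance Definition _ :=
  isGroup.Build affine aff_mulA aff_mul1g aff_mulg1 aff_mulVg aff_mulgV.

Definition is_reflection f : Prop :=
  [/\ f <> 1%g,
      exists2 m : nat, (0 < m)%N & (f ^+ m)%g = 1%g &
      exists (p : E) (H : {vspace E}),
        (\dim H).+1 = \dim {:E} /\ forall v, v \in H -> aff_fun f (p + v) = p + v].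

End Affine.

Coercion aff_fun : affine >-> Funclass.

Definition reflection_presentation (K : fieldType) (E : vectType K)
    (P : pred (affine E)) (G : subGroupType P)
    (k : nat) (rels : word k -> word k -> Prop) : Prop :=
  exists phi : {multiplicative presented rels -> G},
    bijective phi /\ forall i : 'I_k, is_reflection (val (phi (pgen rels i))).

Section Groups.
Variable R : realType.
Implicit Types (alpha : R[i]).

(* The closed fundamental domain: both sides of the boundary are kept. *)
Definition modular_strip alpha : Prop :=
  [/\ 0 < complex.Im alpha, `|complex.Re alpha| <= 2^-1 & 1 <= `|alpha|].

Definition in_lattice alpha (z : R[i]) : Prop :=
  exists a b : int, z = a%:~R + b%:~R * alpha.

Lemma in_lattice0 alpha : in_lattice alpha 0.
Proof. by exists 0, 0; rewrite mul0r addr0. Qed.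

Lemma in_latticeD alpha z w :
  in_lattice alpha z -> in_lattice alpha w -> in_lattice alpha (z + w).
Proof.
move=> [a [b ->]] [a' [b' ->]]; exists (a + a'), (b + b').
by rewrite !rmorphD mulrDl addrACA.
Qed.

Lemma in_latticeN alpha z : in_lattice alpha z -> in_lattice alpha (- z).
Proof.
by move=> [a [b ->]]; exists (- a), (- b); rewrite !rmorphN mulNr opprD.
Qed.

Section GroupG.
Variable n : nat.

Definition signed_perm_mx (eps : 'I_n -> bool) (s : 'S_n) : 'M[R[i]]_n :=
  \matrix_(i, j) ((-1) ^+ eps i *+ (s i == j)).

Lemma mul_signed_perm_mx eps s (z : 'cV[R[i]]_n) i :
  (signed_perm_mx eps s *m z) i 0 = (-1) ^+ eps i * z (s i) 0.
Proof.
rewrite mxE (bigD1 (s i)) //= mxE eqxx big1 ?addr0 // => j /negPf nj.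
by rewrite mxE eq_sym nj mul0r.
Qed.

Definition G21_pred alpha : pred (affine 'cV[R[i]]_n) := fun f =>
  `[< exists (eps : 'I_n -> bool) (s : 'S_n) (t : 'cV[R[i]]_n),
        (forall i, in_lattice alpha (t i 0)) /\
        forall z, f z = signed_perm_mx eps s *m z + t >].

Definition G21 alpha := {f : affine 'cV[R[i]]_n | G21_pred alpha f}.
HB.instance Definition _ alpha := [Choice of G21 alpha by <:].
HB.instance Definition _ alpha := SubChoice.on (G21 alpha).

Fact G21_closed alpha : group_closed (G21_pred alpha).
Proof.
split=> [|f h /asboolP[eps [s [t [tP fE]]]] /asboolP[eps' [s' [t' [t'P hE]]]]].
  apply/asboolP; exists (fun=> false), 1%g, 0; split=> [i|z].
    by rewrite mxE; apply: in_lattice0.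
  rewrite addr0 [LHS]aff_oneE; apply/colP => i.
  by rewrite mul_signed_perm_mx mul1r perm1.
pose k i := (s * s'^-1)%g i.
apply/asboolP; exists (fun i => eps i (+) eps' (k i)), (s * s'^-1)%g.
exists (\col_i (t i 0 - (-1) ^+ (eps i (+) eps' (k i)) * t' (k i) 0)).
split=> [i|z].
  rewrite mxE; apply: in_latticeD => //; apply: in_latticeN.
  by case: (_ (+) _); rewrite ?mulN1r ?mul1r //; apply: in_latticeN.
rewrite [LHS]aff_mulE; set w := aff_fun _ z.
have -> : z = aff_fun h w by rewrite aff_funVK.
have kE i : s' (k i) = s i by rewrite /k permM permKV.
apply/colP => i; rewrite fE hE.
rewrite [LHS]mxE [RHS]mxE !mul_signed_perm_mx -/(k i) [(_ *m w + t') _ _]mxE.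
rewrite mul_signed_perm_mx kE [(\col__ _) _ _]mxE mulrDr mulrA -signr_addb.
rewrite -addbA addbb addbF.
by rewrite -addrA [X in _ = _ + X]addrCA subrr addr0.
Qed.
HB.instance Definition _ alpha :=
  SubChoice_isSubGroup.Build _ (G21_pred alpha) (G21 alpha) (G21_closed alpha).

End GroupG.

Section GroupA.
Variable n : nat.

Definition sum0 : {vspace 'cV[R[i]]_n} :=
  lker (linfun (mulmx (const_mx 1 : 'rV[R[i]]_n))).

Lemma mem_sum0 z : (z \in sum0) = (\sum_i z i 0 == 0).
Proof.
rewrite memv_ker lfunE /=; apply/eqP/eqP => [/matrixP/(_ 0 0)|z0].
  rewrite !mxE => z0; rewrite -[RHS]z0.
  by apply: eq_bigr => i _; rewrite mxE mul1r.
apply/matrixP => a b; rewrite !ord1 !mxE -[RHS]z0.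
by apply: eq_bigr => i _; rewrite mxE mul1r.
Qed.

(* WA n is [W(A_{n-1})]: the index is the number of coordinates, not the rank.
   The translation vector t lies in sum0 by its type. *)
Definition WA_pred alpha : pred (affine (subvs_of sum0)) := fun f =>
  `[< exists (s : 'S_n) (t : subvs_of sum0),
        (forall i, in_lattice alpha (vsval t i 0)) /\
        forall z, vsval (f z) = row_perm s (vsval z) + vsval t >].

Definition WA alpha := {f : affine (subvs_of sum0) | WA_pred alpha f}.
HB.instance Definition _ alpha := [Choice of WA alpha by <:].
HB.instance Definition _ alpha := SubChoice.on (WA alpha).

Fact WA_closed alpha : group_closed (WA_pred alpha).
Proof.
split=> [|f h /asboolP[s [t [tP fE]]] /asboolP[s' [t' [t'P hE]]]].
  apply/asboolP; exists 1%g, 0; split=> [i|z].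
    by rewrite mxE; apply: in_lattice0.
  by rewrite [X in vsval X]aff_oneE row_perm1 addr0.
pose k i := (s * s'^-1)%g i.
have kE i : s' (k i) = s i by rewrite /k permM permKV.
have [fh fhE fhM] : exists2 fh : affine (subvs_of sum0),
    forall z i, vsval (aff_fun fh z) i 0 =
      vsval z (k i) 0 + (vsval t i 0 - vsval t' (k i) 0) & (f * h^-1)%g = fh.
  exists (aff_mul f (aff_inv h)) => // z i.
  rewrite aff_mulE -[in RHS](aff_funVK h z); move: (aff_fun _ z) => w.
  by rewrite fE hE !mxE kE [RHS]addrACA subrr addr0.
have vsval0 i : vsval (0 : subvs_of sum0) i 0 = 0 by rewrite linear0 mxE.
rewrite fhM; apply/asboolP; exists (s * s'^-1)%g, (aff_fun fh 0).
split=> [i|z].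
  rewrite fhE vsval0 add0r; apply: in_latticeD => //; exact: in_latticeN.
apply/colP => i; rewrite [RHS]mxE [X in _ = X + _]mxE -/(k i).
by rewrite [LHS]fhE; congr (_ + _); rewrite [RHS]fhE vsval0 add0r.
Qed.
HB.instance Definition _ alpha :=
  SubChoice_isSubGroup.Build _ (WA_pred alpha) (WA alpha) (WA_closed alpha).

End GroupA.
End Groups.

Arguments G21 {R} n alpha.
Arguments WA {R} n alpha.

Section Relations.

(* sigma i is the word of the i-th generator for 1 <= i <= k.+1 *)
Definition sigma {k : nat} (i : nat) : word k.+1 := [:: (inord i.-1, false)].

Definition asc (a b : nat) := index_iota a b.+1.
Definition desc (b a : nat) := rev (asc a b).

Local Open Scope word_scope.
Local Notation "'s_' i" := (sigma i%N) (at level 1, i at level 1).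

Inductive rels1 : word 3 -> word 3 -> Prop :=
| rels1_sq i : (1 <= i <= 3)%N -> rels1 (s_ i ^+ 2) 1
| rels1_prod : rels1 ((s_ 1 * s_ 2 * s_ 3) ^+ 2) 1.

Inductive relsG (n : nat) : word n.+2 -> word n.+2 -> Prop :=
| relsG_sq i : (1 <= i <= n.+2)%N -> relsG (s_ i ^+ 2) 1
| relsG_prod :
    relsG (((\prod_(i <- asc 1 n.+2) s_ i) * \prod_(i <- desc n 2) s_ i) ^+ 2) 1
| relsG_comm i j : (1 <= i <= n)%N -> (1 <= j <= n)%N ->
    (i.+1 < j)%N || (j.+1 < i)%N -> relsG (s_ i * s_ j) (s_ j * s_ i)
| relsG_comm_end i j : i \in [:: n.+1; n.+2] -> (1 <= j <= n.-1)%N ->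
    relsG (s_ i * s_ j) (s_ j * s_ i)
| relsG_braid i j : (2 <= i <= n)%N -> (2 <= j <= n)%N -> i = j.+1 ->
    relsG (s_ i * s_ j * s_ i) (s_ j * s_ i * s_ j)
| relsG_braid4 :
    relsG (s_ 1 * s_ 2 * s_ 1 * s_ 2) (s_ 2 * s_ 1 * s_ 2 * s_ 1)
| relsG_braid4_end i : i \in [:: n.+1; n.+2] ->
    relsG (s_ i * s_ n * s_ i * s_ n) (s_ n * s_ i * s_ n * s_ i)
| relsG_last :
    relsG (s_ n * s_ n.+1 * (s_ n)^-1 * s_ n.+2)
          (s_ n.+2 * s_ n * s_ n.+1 * (s_ n)^-1).

Inductive relsA (n : nat) : word n.+1 -> word n.+1 -> Prop :=
| relsA_sq i : (1 <= i <= n.+1)%N -> relsA (s_ i ^+ 2) 1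
| relsA_prod :
    relsA (((\prod_(i <- asc 1 n.+1) s_ i) * \prod_(i <- desc n.-1 2) s_ i) ^+ 2)
          1
| relsA_comm i j : (1 <= i <= n.-1)%N -> (1 <= j <= n.-1)%N ->
    (i.+1 < j)%N || (j.+1 < i)%N -> relsA (s_ i * s_ j) (s_ j * s_ i)
| relsA_comm_end i j : i \in [:: n; n.+1] -> (2 <= j <= n - 2)%N ->
    relsA (s_ i * s_ j) (s_ j * s_ i)
| relsA_braid i j : (1 <= i <= n.-1)%N -> (1 <= j <= n.-1)%N -> i = j.+1 ->
    relsA (s_ i * s_ j * s_ i) (s_ j * s_ i * s_ j)
| relsA_braid_end i j : i \in [:: n; n.+1] -> j \in [:: 1; n.-1]%N ->
    relsA (s_ i * s_ j * s_ i) (s_ j * s_ i * s_ j)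
| relsA_last :
    relsA (s_ n.+1 * (\prod_(i <- desc n.-1 1) s_ i) * s_ n * (s_ 1)^-1)
          (s_ n.-1 * (s_ n)^-1 * (\prod_(i <- desc n.-1 1) (s_ i)^-1)
             * (s_ n.+1)^-1).

End Relations.

(* Main.v *)
Require Import Defs.
From HB Require Import structures.
From mathcomp Require Import all_boot all_order all_fingroup all_algebra.
From mathcomp Require Import reals complex boolp.
From mathcomp Require Import zify ring.

(** Write L for the lattice generated by 1 and alpha; it is free on these two
    elements because Im alpha > 0. The group of type G(2,1,n) is then the wreath
    product of {z |-> +-z + t, t in L} with S_n, and the group of type A is the
    semidirect product of S_n with L (x) Q, Q being the root lattice.

    Each presentation is proved in the same way. Reflections of the concrete
    group are exhibited that satisfy the relations, which gives a homomorphism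
    phi from the presented group ([presented_lift]). It is onto because its image
    contains all permutations and all translations ([G21_generated],
    [WA_generated]). For injectivity, a normal form is found in the presented
    group: every element is a product of pieces with explicit integer exponents,
    one piece for each coordinate, times an element coming from S_n. The
    exponents and the permutation can be read off from the affine map that phi
    attaches to such a product, so only the trivial one is sent to 1.

    The permutations are obtained from the Coxeter presentation of S_n
    ([coxeterA_hom]): the generators that satisfy the braid relations define a
    homomorphism rho from S_n to the presented group. Conjugating the other
    generators by rho spreads each of them into a family indexed by coordinates
    ([conj_tperm_orbit]), and a commutation that holds for one pair of
    coordinates holds for all of them ([commute_transport]). Hence the products
    of pieces form a subgroup normalised by rho(S_n), and everything factors
    ([factorization]).

    For G(2,1,n) the pieces at a coordinate i are generated by three involutions
    a_i, b_i, c_i. The long product relation is conjugate to (a_i b_i c_i)^2 = 1,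
    and this makes a_i b_i and a_i c_i commute; both are inverted by a_i
    ([mgen_three_involutions]). So an element of the piece is
    (a_i b_i)^k (a_i c_i)^l a_i^e. This lemma alone gives (i), and
    [wreath_normal_form] gives (ii).

    For type A, sigma_n and sigma_(n+1) are affine reflections along the highest
    root. Times the transposition of the two extreme coordinates they become
    translations, whose conjugates x_i and y_i correspond to the roots
    e_0 - e_i. That the x_i commute with each other and are permuted as roots
    should be ([root_translation_commute], [root_translation_conj]) is the fact
    that the affine Coxeter relations of type A present the affine Weyl group; it
    reduces to a computation in rank two ([affineA2_commute], [affineA2_conj]).
    The last relation of the presentation says exactly that one y commutes with
    one x, and the action of S_n propagates this to all pairs
    ([affine_symmetric_normal_form]).

    Coordinates are numbered from 0 throughout. *)

Set Implicit Arguments.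
Unset Strict Implicit.
Unset Printing Implicit Defensive.

Local Open Scope group_scope.

(** * Multiplicative maps *)

Section Multiplicative.
Variables (G H : groupType) (f : {multiplicative G -> H}).

Lemma hom1 : f 1 = 1.
Proof. by apply: (mulgI (f 1)); rewrite -gmulfM !mulg1. Qed.

Lemma homV : {morph f : x / x^-1}.
Proof. by move=> x; apply/esym/mulg1_eq; rewrite -gmulfM mulgV hom1. Qed.

Lemma homJ : {morph f : x y / x ^ y}.
Proof. by move=> x y; rewrite /conjg !gmulfM homV. Qed.

Lemma hom_prod (I : Type) (l : seq I) (F : I -> G) :
  f (\prod_(i <- l) F i) = \prod_(i <- l) f (F i).
Proof. exact: (big_morph f gmulfM hom1). Qed.

Lemma hom_inj : (forall x, f x = 1 -> x = 1) -> injective f.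
Proof.
by move=> f1 x y fxy; apply/divg1_eq/f1; rewrite gmulfM homV fxy mulgV.
Qed.

End Multiplicative.

(** Stated as an existence so that the composite can be used as a bundled
    morphism. *)
Lemma hom_comp_exists (G1 G2 G3 : groupType) (f : {multiplicative G2 -> G3})
  (h : {multiplicative G1 -> G2}) :
  exists fh : {multiplicative G1 -> G3}, forall x, fh x = f (h x).
Proof.
have fM : {morph f \o h : x y / x * y} by move=> x y; rewrite /= !gmulfM.
pose fmul := isMultiplicative.Build _ _ (f \o h) fM.
pose fh : {multiplicative G1 -> G3} := HB.pack (f \o h) fmul.
by exists fh.
Qed.

(** * Adjacent transpositions and the symmetric group *)

(** The relations among the first m terms of r of the Coxeter group of type A_m. *)
Definition coxeterA (Q : groupType) (m : nat) (r : nat -> Q) : Prop :=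
  [/\ forall j, j < m -> r j * r j = 1,
      forall i j, j < m -> i.+1 < j -> commute (r i) (r j)
    & forall j, j.+1 < m -> r j * r j.+1 * r j = r j.+1 * r j * r j.+1].

Lemma coxeterA_le (Q : groupType) (m m' : nat) (r : nat -> Q) :
  m' <= m -> coxeterA m r -> coxeterA m' r.
Proof.
move=> le [c1 c2 c3]; split=> [j jm|i j jm|j jm].
- by apply: c1; lia.
- by apply: c2; lia.
- by apply: c3; lia.
Qed.

Definition downto (m k : nat) := rev (index_iota k m).

Lemma downtoS m k : k <= m -> downto m.+1 k = m :: downto m k.
Proof.
by move=> km; rewrite /downto /index_iota subSn // -addn1 iotaD rev_cat /= subnKC.
Qed.

Lemma downto_rcons m k : k < m -> downto m k = rcons (downto m k.+1) k.
Proof.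
by move=> km; rewrite /downto -rev_cons /index_iota subnS -(subnSK km).
Qed.

Lemma downto_nil m : downto m m = [::].
Proof. by rewrite /downto /index_iota subnn. Qed.

Lemma mem_downto m k j : (j \in downto m k) = (k <= j < m).
Proof. by rewrite mem_rev mem_index_iota. Qed.

(** Push r j to the left through the factors smaller than j - 1, apply the braid
    relation of r j and r j.-1, and push the resulting r j.-1 through the rest. *)
Lemma downto_shift (Q : groupType) (r : nat -> Q) m k j :
    coxeterA m r -> k < j < m ->
  (\prod_(i <- downto m k) r i) * r j = r j.-1 * \prod_(i <- downto m k) r i.
Proof.
elim: m => [|m IH] cox /andP[kj jm]; first by lia.
have km : k < m by lia.
have [_ comm braid] := cox.
rewrite downtoS ?(ltnW km) // big_cons.
have [jm'|mj] := ltnP j m.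
  rewrite -mulgA IH ?kj //; last exact: coxeterA_le cox.
  rewrite !mulgA; congr (_ * _); apply/esym/comm => //; lia.
have -> : j = m by lia.
case: m km {IH jm mj} cox comm braid => // m km cox comm braid.
rewrite downtoS // big_cons /=.
have cm : commute (r m.+1) (\prod_(i <- downto m k) r i).
  rewrite big_seq; apply: commute_prod => i; rewrite mem_downto => ?.
  by apply/commute_sym/comm; lia.
by rewrite -!mulgA -cm !mulgA braid.
Qed.

(** The cosets of the parabolic subgroup of the first m generators in that of the
    first m + 1 are represented by the descending products: right multiplication
    by a generator either moves from one representative to another or passes
    through it by [downto_shift]. The rewriting of words is independent of the
    group, so that it can be read both in an arbitrary Q and in S_n. *)
Lemma coxeterA_word m (l : seq nat) : all (gtn m.+1) l ->
  exists (l' : seq nat) (k : nat), [/\ all (gtn m) l', k <= m.+1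
    & forall (Q : groupType) (r : nat -> Q), coxeterA m.+1 r ->
        \prod_(j <- l) r j =
        (\prod_(j <- l') r j) * \prod_(j <- downto m.+1 k) r j].
Proof.
elim/last_ind: l => [|l j IH].
  move=> _; exists [::], m.+1; split=> // Q r _.
  by rewrite downto_nil !big_nil mulg1.
rewrite all_rcons => /andP[/= jm /IH[l' [k [l'm km lE]]]].
have [jk|kj|jk] := ltngtP j k; last 1 first.
- move: jm; rewrite jk => {j jk} jm; exists l', k.+1; split=> // Q r cox.
  have [sq _ _] := cox.
  rewrite -cats1 big_cat /= lE // big_seq1 -mulgA; congr (_ * _).
  by rewrite downto_rcons // -cats1 big_cat /= big_seq1 -mulgA sq // mulg1.
- have [jk1|jk1] := eqVneq j.+1 k.
    exists l', j; split=> // [|Q r cox]; first exact: ltnW.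
    rewrite downto_rcons // jk1 -!cats1 !big_cat /= lE // !big_seq1.
    by rewrite mulgA.
  exists (rcons l' j), k; split=> // [|Q r cox].
    by rewrite all_rcons l'm andbT /=; lia.
  have [_ comm _] := cox.
  rewrite -!cats1 !big_cat /= lE // !big_seq1 -!mulgA; congr (_ * _).
  apply/commute_sym; rewrite big_seq; apply: commute_prod => i.
  by rewrite mem_downto => ?; apply: comm; lia.
- exists (rcons l' j.-1), k; split=> // [|Q r cox].
    by rewrite all_rcons l'm andbT /=; lia.
  rewrite -!cats1 !big_cat /= lE // !big_seq1 -!mulgA; congr (_ * _).
  by rewrite downto_shift // kj.
Qed.

Definition adj (n j : nat) : 'S_n.+1 := tperm (inord j) (inord j.+1).

Lemma inord_eq n i j : i <= n -> j <= n ->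
  (inord i == inord j :> 'I_n.+1) = (i == j).
Proof. by move=> ni nj; rewrite -val_eqE /= !inordK. Qed.

Lemma adj_neq n j : j < n -> inord j != inord j.+1 :> 'I_n.+1.
Proof. by move=> jn; rewrite inord_eq; lia. Qed.

Lemma adjE n j (i : 'I_n.+1) : j < n ->
  adj n j i = (if i == j :> nat then j.+1 else
               if i == j.+1 :> nat then j else i) :> nat.
Proof.
move=> jn; have ni := ltn_ord i.
have jE : (inord j : 'I_n.+1) = j :> nat by rewrite inordK; lia.
have j1E : (inord j.+1 : 'I_n.+1) = j.+1 :> nat by rewrite inordK; lia.
rewrite /adj; case: tpermP => [->|->|/eqP + /eqP].
- by rewrite jE j1E eqxx.
- by rewrite jE j1E eqxx; case: eqP; lia.
- by rewrite -!val_eqE /= jE j1E => /negPf -> /negPf ->.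
Qed.

Lemma adj_coxeterA n : coxeterA n (adj n).
Proof.
split=> [j jn|i j jn ij|j jn].
- exact: tperm2.
- apply/permP => k; apply: val_inj; rewrite /= !permM !adjE; try lia.
  by do !case: eqP; lia.
- apply/permP => k; apply: val_inj; rewrite /= !permM !adjE; try lia.
  by do !case: eqP; lia.
Qed.

Lemma prod_adj_fix n (l : seq nat) (i : 'I_n.+1) :
  (forall j, j \in l -> [/\ j < n, i != j :> nat & i != j.+1 :> nat]) ->
  (\prod_(j <- l) adj n j) i = i.
Proof.
elim: l => [|j l IH] H; first by rewrite big_nil perm1.
rewrite big_cons permM.
have [jn ij ij1] := H j (mem_head _ _).
have -> : adj n j i = i.
  by apply: val_inj; rewrite /= adjE // (negPf ij) (negPf ij1).
by apply: IH => k kl; apply: H; rewrite inE kl orbT.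
Qed.

Lemma prod_adj_downto n m k (i : 'I_n.+1) : k <= m <= n ->
  (\prod_(j <- downto m k) adj n j) i
  = (if i == m :> nat then k else if k <= i < m then i.+1 else i) :> nat.
Proof.
move=> /andP[km mn]; elim: m km mn i => [|m IH] km mn i.
  by case: k km => // _; rewrite downto_nil big_nil perm1; case: eqP.
have [->|nk] := eqVneq k m.+1.
  by rewrite downto_nil big_nil perm1; do !case: ifP; lia.
rewrite downtoS; last by lia.
rewrite big_cons permM IH; try lia.
rewrite adjE //; do !case: ifP; lia.
Qed.

(** Injectivity of the Coxeter presentation. In the factorization of
    [coxeterA_word] the first factor fixes the last point and the descending
    product moves it to k, so a trivial permutation forces k to be the last point
    and the descending product to be empty. *)
Lemma coxeterA_inj N n (l : seq nat) : n <= N -> all (gtn n) l ->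
    \prod_(j <- l) adj N j = 1 ->
  forall (Q : groupType) (r : nat -> Q), coxeterA n r -> \prod_(j <- l) r j = 1.
Proof.
elim: n l => [|n IH] l nN ln l1 Q r cox.
  by case: l ln {l1} => //; rewrite big_nil.
have [l' [k [l'n kn lE]]] := coxeterA_word ln.
have adjlE := lE _ _ (coxeterA_le nN (adj_coxeterA N)).
move/permP/(_ (inord n.+1))/(congr1 (@nat_of_ord _)): (l1); rewrite perm1 adjlE permM.
rewrite (prod_adj_fix (l := l')) => [|j jl']; last first.
  by have /= jn := allP l'n _ jl'; rewrite !inordK //; split; lia.
rewrite prod_adj_downto ?kn // inordK // eqxx => kE.
rewrite lE // kE downto_nil big_nil mulg1.
apply: (IH l' (ltnW nN) l'n _ Q r (coxeterA_le (leqnSn n) cox)).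
by move: l1; rewrite adjlE kE downto_nil big_nil mulg1.
Qed.

(** Permutations supported in the interval [k, l] are products of adjacent
    transpositions of that interval. This serves as the generation statement for
    S_n itself and for the stabilisers of extreme points. *)
Lemma tperm_interval_ind n k l (Pr : 'S_n.+1 -> Prop) :
    Pr 1 -> (forall s t, Pr s -> Pr t -> Pr (s * t)) ->
    (forall j, k <= j < l -> j < n -> Pr (adj n j)) ->
  forall s : 'S_n.+1, (forall i : 'I_n.+1, ~~ (k <= i <= l) -> s i = i) -> Pr s.
Proof.
move=> Pr1 PrM Pradj.
have Prt d (i j : 'I_n.+1) : k <= i -> i + d = j :> nat -> j <= l ->
    Pr (tperm i j).
  elim: d i j => [|d IH] i j ki ij jl.
    by rewrite (_ : i = j) ?tperm1 //; apply: val_inj => /=; lia.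
  have jn := ltn_ord j.
  have [d0|d0] := posnP d.
    have -> : tperm i j = adj n i.
      by rewrite /adj; congr tperm; apply: val_inj; rewrite /= inordK //; lia.
    by apply: Pradj; lia.
  pose j' : 'I_n.+1 := inord j.-1.
  have j'E : j' = j.-1 :> nat by rewrite inordK; lia.
  have -> : tperm i j = adj n j' * tperm i j' * adj n j'.
    have adjV : (adj n j')^-1 = adj n j' by rewrite tpermV.
    rewrite -{1}adjV -mulgA -conjgE tpermJ; congr tperm; apply: val_inj => /=.
      by rewrite adjE; do ?case: ifP; lia.
    by rewrite adjE; do ?case: ifP; lia.
  by apply: (PrM); [apply: (PrM)|]; [apply: Pradj|apply: IH|apply: Pradj]; lia.
have {Prt} Prt (i j : 'I_n.+1) : k <= i <= l -> k <= j <= l -> Pr (tperm i j).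
  move=> ? ?; case: (leqP i j) => ij; last rewrite tpermC.
    by apply: (Prt (j - i)); lia.
  by apply: (Prt (i - j)); lia.
(* A transposition of k and s k reduces to a permutation fixing k as well. *)
move=> s; have [d] := ubnP (l.+1 - k).
elim: d k s {Pradj} Prt => // d IH k s Prt dk fs.
have [lk|kl] := ltnP l k.
  rewrite (_ : s = 1) //; apply/permP => i; rewrite perm1 fs //; lia.
have [nk|kn] := ltnP n k.
  rewrite (_ : s = 1) //; apply/permP => i; rewrite perm1 fs //.
  by have := ltn_ord i; lia.
pose K : 'I_n.+1 := inord k; have KE : K = k :> nat by rewrite inordK.
have sK : k <= s K <= l.
  have : ~~ ~~ (k <= s K <= l); last by rewrite negbK.
  apply/negP => /[dup] sKn /fs /perm_inj sKK; move: sKn; rewrite sKK; lia.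
rewrite -[s](mulgK (tperm (s K) K)) tpermV; apply: PrM; last by apply: Prt; lia.
apply: (IH k.+1) => [i j ? ?||i iN]; [by apply: Prt; lia|lia|].
rewrite permM; have [->|iK] := eqVneq i K; first by rewrite tpermL.
have si : s i = i.
  apply: fs; apply: contra iN => ?.
  by move: iK; rewrite -val_eqE /= KE; lia.
rewrite si tpermD // 1?eq_sym //; apply: contra iK => /eqP sKi.
by apply/eqP/(@perm_inj _ s); rewrite si.
Qed.

Lemma prod_rev_coxeterA n (Q : groupType) (r : nat -> Q) (l : seq nat) :
  coxeterA n r -> all (gtn n) l -> \prod_(j <- rev l) r j = (\prod_(j <- l) r j)^-1.
Proof.
move=> [sq _ _] ln; rewrite -{2}[l]revK -prodgV big_seq [RHS]big_seq.
apply: eq_bigr => j; rewrite mem_rev => /(allP ln) /= jn.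
by apply/esym/mulg1_eq/sq.
Qed.

(** The Coxeter presentation of the symmetric group, as a universal property:
    choose a word for each permutation and multiply the corresponding r; by
    [coxeterA_inj] the result depends only on the permutation. *)
Lemma coxeterA_hom n (Q : groupType) (r : nat -> Q) : coxeterA n r ->
  exists rho : {multiplicative 'S_n.+1 -> Q}, forall j, j < n -> rho (adj n j) = r j.
Proof.
move=> cox.
have /choice[w wP] (s : 'S_n.+1) :
    exists l, all (gtn n) l /\ \prod_(j <- l) adj n j = s.
  pose Pr s := exists l, all (gtn n) l /\ \prod_(j <- l) adj n j = s.
  apply: (@tperm_interval_ind n 0 n Pr) => /= [|u v [l [ln <-]] [l' [ln' <-]]|j _ jn|i].
  - by exists [::]; rewrite big_nil.
  - by exists (l ++ l'); rewrite all_cat ln ln' big_cat.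
  - by exists [:: j]; rewrite /= jn big_seq1.
  - by have := ltn_ord i; lia.
have uniq_prod l l' : all (gtn n) l -> all (gtn n) l' ->
    \prod_(j <- l) adj n j = \prod_(j <- l') adj n j ->
    \prod_(j <- l) r j = \prod_(j <- l') r j.
  move=> ln ln' ll'; apply: divg1_eq; rewrite -(prod_rev_coxeterA cox) // -big_cat.
  apply: (@coxeterA_inj n n) => //; first by rewrite all_cat all_rev ln.
  by rewrite big_cat /= ll' (prod_rev_coxeterA (adj_coxeterA n)) ?mulgV.
pose f s := \prod_(j <- w s) r j.
have fM : {morph f : s t / s * t}.
  move=> s t; rewrite /f -big_cat; apply: uniq_prod.
  - by case: (wP (s * t)).
  - by rewrite all_cat; case: (wP s) => -> _; case: (wP t) => -> _.
  - rewrite big_cat /=; case: (wP s) => _ ->; case: (wP t) => _ ->.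
    by case: (wP (s * t)) => _ ->.
pose fmul := isMultiplicative.Build _ _ f fM.
pose rho : {multiplicative 'S_n.+1 -> Q} := HB.pack f fmul.
exists rho => j jn; have -> : r j = \prod_(i <- [:: j]) r i by rewrite big_seq1.
apply: uniq_prod.
- by case: (wP (adj n j)).
- by rewrite /= jn.
- by case: (wP (adj n j)) => _ ->; rewrite big_seq1.
Qed.

Section CyclicShift.
Variables (n : nat) (Q : groupType) (r : nat -> Q) (rho : {multiplicative 'S_n.+1 -> Q}).
Hypothesis rhoE : forall j, j < n -> rho (adj n j) = r j.

Lemma rho_downto k : rho (\prod_(j <- downto n k) adj n j) = \prod_(j <- downto n k) r j.
Proof.
rewrite hom_prod big_seq [RHS]big_seq; apply: eq_bigr => j.
by rewrite mem_downto => /andP[_ jn]; apply: rhoE.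
Qed.

Lemma rho_upto k : coxeterA n r ->
  \prod_(j <- index_iota k n) r j = (rho (\prod_(j <- downto n k) adj n j))^-1.
Proof.
move=> cox; rewrite rho_downto -(prod_rev_coxeterA cox) ?revK //.
by apply/allP => j; rewrite mem_downto => /andP[].
Qed.

Lemma rho_unique (rho' : {multiplicative 'S_n.+1 -> Q}) :
  (forall j, j < n -> rho' (adj n j) = r j) -> rho' =1 rho.
Proof.
move=> rhoE' s; apply: (@tperm_interval_ind n 0 n (fun s => rho' s = rho s))
  => [|u v IHu IHv|j _ jn|i].
- by rewrite !hom1.
- by rewrite !gmulfM IHu IHv.
- by rewrite rhoE // rhoE'.
- by have := ltn_ord i; lia.
Qed.

End CyclicShift.

Lemma coxeterA_image n (Q : groupType) (r : nat -> Q) (f : {multiplicative 'S_n.+1 -> Q}) :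
  (forall j, j < n -> r j = f (adj n j)) -> coxeterA n r.
Proof.
move=> rE; have [sq comm braid] := adj_coxeterA n.
split=> [j jn|i j jn ij|j jn]; rewrite /commute !rE -?gmulfM; try lia.
- by rewrite sq // hom1.
- by rewrite comm.
- by rewrite braid.
Qed.

(** Used with f the map out of a presented group, rho the permutations found in
    that group and sigma the permutations of the coordinates. *)
Lemma hom_perm_ext n (G1 G2 : groupType) (f : {multiplicative G1 -> G2})
    (rho : {multiplicative 'S_n.+1 -> G1}) (sigma : {multiplicative 'S_n.+1 -> G2}) :
  (forall j, j < n -> f (rho (adj n j)) = sigma (adj n j)) -> forall s, f (rho s) = sigma s.
Proof.
move=> H s; have [h hE] := hom_comp_exists f rho; rewrite -hE.
by apply: (@rho_unique _ _ (fun j => sigma (adj n j))) => // j jn; rewrite hE H.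
Qed.

(** Splits on an innermost conditional, so that its test is free of conditionals. *)
Ltac inner_ifs :=
  repeat match goal with |- context[if ?b then _ else _] =>
    lazymatch b with
    | context[if _ then _ else _] => fail
    | _ => case: (boolP b) => ?; try (exfalso; lia)
    end end; lia.

Lemma descending_cycleE n (i : 'I_n.+1) :
  (\prod_(j <- downto n 0) adj n j) i = (if i == n :> nat then 0 else i.+1)%N :> nat.
Proof.
rewrite prod_adj_downto ?leqnn //; have := ltn_ord i.
by do !case: ifP; lia.
Qed.

Lemma tperm_endsE n (i : 'I_n.+1) : tperm ord0 ord_max i =
  (if i == 0 :> nat then n else if i == n :> nat then 0 else i)%N :> nat.
Proof.
case: tpermP => [->|->|/eqP + /eqP] /=.
- by [].
- by rewrite eqxx; case: ifP; lia.
- by rewrite -!val_eqE /= => /negPf -> /negPf ->.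
Qed.

(** The image in S_n of the last relation of the presentation of type A, with the
    two affine reflections both replaced by the transposition of the end points. *)
Lemma descending_cycle_relation n (d := \prod_(j <- downto n 0) adj n j)
    (theta := tperm ord0 ord_max : 'S_n.+1) : 1 < n ->
  theta * d * theta * adj n 0 = adj n n.-1 * theta * d * theta.
Proof.
move=> n_gt1; apply/permP => i; apply: val_inj; rewrite !permM /=.
rewrite !(adjE, descending_cycleE, tperm_endsE); try lia.
by have := ltn_ord i; inner_ifs.
Qed.

(** * Conjugation orbits *)

Section ConjugationOrbits.
Variables (n : nat) (Q : groupType) (rho : {multiplicative 'S_n.+1 -> Q}).

Lemma commute_interval (k l : nat) (b : Q) :
    (forall j, k <= j < l -> j < n -> commute b (rho (adj n j))) ->
  forall s : 'S_n.+1, (forall i : 'I_n.+1, ~~ (k <= i <= l) -> s i = i) ->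
  commute b (rho s).
Proof.
move=> br; apply: tperm_interval_ind => // [|s t bs bt].
  by rewrite hom1; apply: commute1.
by rewrite gmulfM; apply: commuteM.
Qed.

(** If b is centralised by the permutations that fix F and base, its conjugates
    under the permutations that fix F depend only on the image of base. *)
Lemma conj_tperm_orbit (F : pred 'I_n.+1) (base : 'I_n.+1) (b : Q) :
    (forall s : 'S_n.+1, {in F, forall k, s k = k} -> s base = base -> commute b (rho s)) ->
    base \notin F ->
  forall (s : 'S_n.+1) (i : 'I_n.+1), {in F, forall k, s k = k} -> i \notin F ->
  (b ^ rho (tperm base i)) ^ rho s = b ^ rho (tperm base (s i)).
Proof.
move=> bs baseF s i sF iF.
have siF : s i \notin F.
  by apply: contra iF => siF; have /perm_inj <- := sF _ siF.
rewrite -conjgM -gmulfM -[X in rho X](mulgVK (tperm base (s i))).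
rewrite gmulfM conjgM tpermV [b ^ rho (_ * _)]conjgE bs ?mulKg //; last first.
  by rewrite !permM tpermL tpermR.
move=> k kF; rewrite !permM.
have tF x : x \notin F -> tperm base x k = k.
  by move=> xF; rewrite tpermD //; [apply: contraNneq baseF|apply: contraNneq xF] => ->.
by rewrite tF // (sF k) // tF.
Qed.

End ConjugationOrbits.

(** The permutations fixing F are doubly transitive on the complement of F. *)
Lemma perm_pair_transport n (F : pred 'I_n.+1) (i j i' j' : 'I_n.+1) :
    i != j -> i' != j' -> i \notin F -> j \notin F -> i' \notin F -> j' \notin F ->
  exists s : 'S_n.+1, [/\ s i = i', s j = j' & {in F, forall k, s k = k}].
Proof.
move=> ij ij' iF jF iF' jF'.
have tF x y k : x \notin F -> y \notin F -> k \in F -> tperm x y k = k.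
  by move=> xF yF kF; rewrite tpermD //; [apply: contraNneq xF|apply: contraNneq yF] => ->.
have j1F : tperm i i' j \notin F.
  by case: tpermP.
exists (tperm i i' * tperm (tperm i i' j) j'); split.
- have ji : tperm i i' j != i' by rewrite -[X in _ != X](tpermL i i') (inj_eq perm_inj) eq_sym.
  have ji' : j' != i' by rewrite eq_sym.
  by rewrite permM tpermL (tpermD ji ji').
- by rewrite permM tpermL.
- by move=> k kF; rewrite permM !(tF _ _ k).
Qed.

Lemma commute_transport n (Q : groupType) (rho : {multiplicative 'S_n.+1 -> Q})
    (F : pred 'I_n.+1) (u v : 'I_n.+1 -> Q) (i j : 'I_n.+1) :
    (forall (s : 'S_n.+1) k, {in F, forall i, s i = i} -> k \notin F -> u k ^ rho s = u (s k)) ->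
    (forall (s : 'S_n.+1) k, {in F, forall i, s i = i} -> k \notin F -> v k ^ rho s = v (s k)) ->
    i \notin F -> j \notin F -> i != j -> commute (u i) (v j) ->
  forall i' j', i' \notin F -> j' \notin F -> i' != j' -> commute (u i') (v j').
Proof.
move=> uJ vJ iF jF ij uv i' j' iF' jF' ij'.
have [s [si sj sF]] := perm_pair_transport ij ij' iF jF iF' jF'.
by rewrite /commute -si -sj -uJ // -vJ // -!conjMg uv.
Qed.

(** * Products of commuting submonoids *)

(** The submonoid generated by S, presented as a left-to-right word so that
    normal forms are established by multiplying with one generator at a time. *)
Inductive mgen (Q : groupType) (S : Q -> Prop) : Q -> Prop :=
| mgen1 : mgen S 1
| mgenM x y : S x -> mgen S y -> mgen S (x * y).

Section Mgen.
Variables (Q : groupType).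
Implicit Types S : Q -> Prop.

Lemma mgen_in S x : S x -> mgen S x.
Proof. by move=> Sx; rewrite -[x]mulg1; apply: mgenM => //; apply: mgen1. Qed.

Lemma mgen_mul S x y : mgen S x -> mgen S y -> mgen S (x * y).
Proof. by elim=> [|a b Sa _ IH] Sy; rewrite ?mul1g // -mulgA; apply: mgenM; auto. Qed.

Lemma mgen_commute S S' : (forall x y, S x -> S' y -> commute x y) ->
  forall x y, mgen S x -> mgen S' y -> commute x y.
Proof.
move=> SS' x y Sx S'y; elim: Sx => [|a b Sa _ IH]; first exact/commute_sym/commute1.
apply/commute_sym/commuteM; last exact: commute_sym.
elim: S'y {IH} => [|c d Sc _ IH]; first exact/commute_sym/commute1.
by apply/commute_sym/commuteM; [apply: SS'|apply: commute_sym].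
Qed.

End Mgen.

Lemma mgen_sub (Q : groupType) (S S' : Q -> Prop) :
  (forall x, S x -> mgen S' x) -> forall x, mgen S x -> mgen S' x.
Proof.
by move=> SS' x; elim=> [|a b Sa _ IH]; [apply: mgen1|apply: mgen_mul => //; apply: SS'].
Qed.

Section Factorization.
Variables (n : nat) (Q : groupType) (U : 'I_n -> Q -> Prop).
Hypothesis U_commute : forall i j x y, i != j -> U i x -> U j y -> commute x y.
Let M i := mgen (U i).

Definition prod_of (x : Q) := exists2 u : 'I_n -> Q, forall i, M i (u i) & x = \prod_i u i.

Lemma prod_of1 : prod_of 1.
Proof. by exists (fun=> 1) => [i|]; [apply: mgen1|rewrite big1]. Qed.

Lemma prod_of_in i x : M i x -> prod_of x.
Proof.
move=> Mx; exists (fun j => if j == i then x else 1) => [j|].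
  by case: eqP => [->|_] //; apply: mgen1.
by rewrite -big_mkcond big_pred1_eq.
Qed.

Lemma prod_ofM x y : prod_of x -> prod_of y -> prod_of (x * y).
Proof.
move=> [u uM ->] [v vM ->]; exists (fun i => u i * v i) => [i|].
  by apply: mgen_mul; [apply: uM|apply: vM].
elim: (index_enum _) (index_enum_uniq 'I_n) => [|i l IH] /=; first by rewrite !big_nil mulg1.
case/andP=> il ul; rewrite !big_cons -IH // !mulgA; congr (_ * _).
rewrite -!mulgA; congr (_ * _); apply/commute_sym; rewrite big_seq.
apply: commute_prod => j jl; apply: mgen_commute (vM i) (uM j) => a b.
by apply: U_commute; apply: contraNneq il => ->.
Qed.

Lemma prod_of_prod (I : Type) (l : seq I) (F : I -> Q) :
  (forall i, prod_of (F i)) -> prod_of (\prod_(i <- l) F i).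
Proof.
move=> FP; elim: l => [|i l IH]; first by rewrite big_nil; apply: prod_of1.
by rewrite big_cons; apply: prod_ofM.
Qed.

Lemma prod_of_conj g : (forall i x, U i x -> prod_of (x ^ g)) ->
  forall x, prod_of x -> prod_of (x ^ g).
Proof.
move=> Ug x [u uM ->]; rewrite conjg_prod; apply: prod_of_prod => i.
elim: (uM i) => [|a b Ua _ IH]; first by rewrite conj1g; apply: prod_of1.
by rewrite conjMg; apply: prod_ofM => //; apply: Ug Ua.
Qed.

(** The products of elements of the U i form a submonoid normalised by the image
    of rho; hence multiplying such a product followed by a permutation with
    another generator keeps this shape. *)
Lemma factorization m (rho : {multiplicative 'S_m -> Q}) :
    (forall i x s, U i x -> prod_of (x ^ rho s)) ->
  forall x, mgen (fun y => (exists s, y = rho s) \/ exists i, U i y) x ->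
  exists u s, (forall i, M i (u i)) /\ x = (\prod_i u i) * rho s.
Proof.
move=> Uconj x.
suff H : mgen (fun y => (exists s, y = rho s) \/ exists i, U i y) x ->
    exists2 t, prod_of t & exists s, x = t * rho s.
  by case/H => _ [u uM ->] [s ->]; exists u, s.
elim=> [|y b [[s ->]|[i Uy]] _ [t tP [s' ->]]].
- by exists 1; [apply: prod_of1|exists 1; rewrite hom1 mulg1].
- exists (t ^ rho s^-1).
    by apply: prod_of_conj tP => i a; apply: Uconj.
  by exists (s * s'); rewrite conjgE homV invgK gmulfM !mulgA mulgVK.
- exists (y * t); last by exists s'; rewrite mulgA.
  by apply: prod_ofM => //; apply: (prod_of_in (mgen_in Uy)).
Qed.

End Factorization.

(** * Rank-two lattices, three involutions, affine A2 *)

Definition expgz (Q : groupType) (x : Q) (m : int) : Q :=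
  match m with Posz k => x ^+ k | Negz k => x ^- k.+1 end.

Definition lattice_word (Q : groupType) (x y : Q) (k : int * int) : Q :=
  expgz x k.1 * expgz y k.2.

Section LatticeWords.
Variable Q : groupType.
Implicit Types (x y a b c g : Q) (m : int) (k : int * int).

Lemma mul_expgz x m : x * expgz x m = expgz x (1 + m)%R.
Proof.
case: m => [m|[|m]] /=; first by rewrite -expgS.
  by rewrite expg1 mulgV.
by rewrite subn1 [x ^+ m.+2]expgSr invgM mulVKg.
Qed.

Lemma mulV_expgz x m : x^-1 * expgz x m = expgz x (m - 1)%R.
Proof. by apply: (mulgI x); rewrite mulVKg mul_expgz; congr expgz; lia. Qed.

Lemma commute_expgz x y m : commute x y -> commute x (expgz y m).
Proof.
move=> xy; case: m => m /=; first exact: commuteX.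
by apply: commuteV; apply: commuteX.
Qed.

Lemma conj_expgz x g m : expgz x m ^ g = expgz (x ^ g) m.
Proof. by case: m => m /=; rewrite ?conjVg conjXg. Qed.

Lemma expgzV x m : expgz x^-1 m = expgz x (- m)%R.
Proof. by case: m => [[|m]|m] /=; rewrite ?expVgn ?invgK // invg1. Qed.

Lemma hom_expgz (Q' : groupType) (f : {multiplicative Q -> Q'}) x m :
  f (expgz x m) = expgz (f x) m.
Proof.
have fX j : f (x ^+ j) = f x ^+ j by elim: j => [|j IH]; rewrite ?hom1 // !expgS gmulfM IH.
by case: m => m /=; rewrite ?homV fX.
Qed.

Lemma hom_lattice_word (Q' : groupType) (f : {multiplicative Q -> Q'}) x y k :
  f (lattice_word x y k) = lattice_word (f x) (f y) k.
Proof. by rewrite gmulfM !hom_expgz. Qed.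

Lemma lattice_word0 x y : lattice_word x y (0, 0)%R = 1.
Proof. exact: mulg1. Qed.

Section Commuting.
Variables (x y : Q).
Hypothesis xy : commute x y.

Lemma mul_lattice_word g k :
    g = x \/ g = x^-1 \/ g = y \/ g = y^-1 ->
  exists k', g * lattice_word x y k = lattice_word x y k'.
Proof.
have yx m : commute y (expgz x m) by apply: commute_expgz; apply: commute_sym.
have Vyx m : commute y^-1 (expgz x m).
  by apply/commute_sym; apply: commuteV; apply/commute_sym.
rewrite /lattice_word; case=> [|[|[]]] ->.
- by exists (1 + k.1, k.2)%R; rewrite mulgA mul_expgz.
- by exists (k.1 - 1, k.2)%R; rewrite mulgA mulV_expgz.
- by exists (k.1, 1 + k.2)%R; rewrite mulgA yx -mulgA mul_expgz.
- by exists (k.1, k.2 - 1)%R; rewrite mulgA Vyx -mulgA mulV_expgz.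
Qed.

Lemma mgen_lattice_word g :
    mgen (fun h => h = x \/ h = x^-1 \/ h = y \/ h = y^-1) g ->
  exists k, g = lattice_word x y k.
Proof.
elim=> [|h g' hxy _ [k ->]]; first by exists (0, 0)%R; rewrite lattice_word0.
exact: mul_lattice_word.
Qed.

End Commuting.

Section ThreeInvolutions.
Variables (a b c : Q).
Hypotheses (aa : a * a = 1) (bb : b * b = 1) (cc : c * c = 1).
Hypothesis abc : (a * b * c) ^+ 2 = 1.
Let x := a * b.
Let y := a * c.

Let aV : a^-1 = a. Proof. exact: mulg1_eq. Qed.
Let bV : b^-1 = b. Proof. exact: mulg1_eq. Qed.
Let cV : c^-1 = c. Proof. exact: mulg1_eq. Qed.

(** The relation reads abc = cba; cyclically permuted it becomes cab = bac. *)
Lemma three_involutions_commute : commute x y.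
Proof.
have abcV : a * b * c = c * b * a.
  by have := mulg1_eq abc; rewrite !invgM aV bV cV mulgA => ->.
have cab : c * a * b = b * a * c.
  by rewrite -[LHS]mulg1 -cc -[RHS]mul1g -{1}cc -!mulgA (mulgA a) (mulgA (a * b)) abcV !mulgA.
by rewrite /commute /x /y -!mulgA (mulgA b) -cab !mulgA.
Qed.

(** The group with three generators and relations a^2 = b^2 = c^2 = (abc)^2 = 1
    is Z^2 extended by an involution a that inverts Z^2: ab and ac commute and
    are inverted by a. *)
Lemma mgen_three_involutions g : mgen (fun h => h = a \/ h = b \/ h = c) g ->
  exists k (e : bool), g = lattice_word x y k * a ^+ e.
Proof.
have xa : x ^ a = x^-1 by rewrite /x conjgE invgM aV bV !mulgA aa mul1g.
have ya : y ^ a = y^-1 by rewrite /y conjgE invgM aV cV !mulgA aa mul1g.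
have mula k (e : bool) :
    a * (lattice_word x y k * a ^+ e) = lattice_word x y (- k.1, - k.2)%R * a ^+ ~~ e.
  rewrite mulgA (conjgCV a) aV conjMg !conj_expgz xa ya !expgzV -mulgA.
  by case: e; rewrite /= ?expg1 ?expg0 ?aa ?mulg1.
have mulX h k (e : bool) : h = x \/ h = x^-1 \/ h = y \/ h = y^-1 ->
    exists k' (e' : bool), h * (lattice_word x y k * a ^+ e) = lattice_word x y k' * a ^+ e'.
  move=> /(mul_lattice_word three_involutions_commute k)[k' hk].
  by exists k', e; rewrite mulgA hk.
elim=> [|h g' + _ [k [e ->]]]; first by exists (0, 0)%R, false; rewrite lattice_word0 mulg1.
case=> [|[]] ->.
- by rewrite mula; eexists; eexists.
(* Multiplication by b or c reduces to multiplication by a and a translation. *)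
- have -> : b = x^-1 * a by rewrite invgM aV bV -mulgA aa mulg1.
  by rewrite -mulgA mula; apply: mulX; auto.
- have -> : c = y^-1 * a by rewrite invgM aV cV -mulgA aa mulg1.
  by rewrite -mulgA mula; apply: mulX; auto.
Qed.

End ThreeInvolutions.

(** A and B are to be thought of as the simple reflections of S_3 and C as the
    affine reflection along the highest root. Then A C A is parallel to B, so
    A C A B is a translation along the root of B; conjugating it by A gives the
    translation C A B A along the highest root. *)
Section AffineA2.
Variables A B C : Q.
Hypotheses (AA : A * A = 1) (BB : B * B = 1) (CC : C * C = 1).
Hypotheses (AB : A * B * A = B * A * B) (BC : B * C * B = C * B * C).
Hypothesis AC : A * C * A = C * A * C.

Let zE : C * A * B * A = C * B * A * B.
Proof. by rewrite -(mulgA C A) -(mulgA C (A * B)) AB !mulgA. Qed.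

Lemma affineA2_commute : commute (A * C * A * B) (C * A * B * A).
Proof.
rewrite /commute {1}zE.
have -> : A * C * A * B * (C * B * A * B) = (A * C * A) * (B * C * B) * (A * B).
  by rewrite !mulgA.
(* Only the first A C A is to be rewritten; the one on the right stays. *)
by rewrite {1}AC BC -!mulgA (mulgA C C) CC mul1g (mulgA A A) AA mul1g.
Qed.

Lemma affineA2_conj : (C * A * B * A) ^ B = (C * A * B * A) * (A * C * A * B)^-1.
Proof.
rewrite !invgM (mulg1_eq AA) (mulg1_eq BB) (mulg1_eq CC) conjgE (mulg1_eq BB) {1}zE.
have ABABA w : A * (B * (A * (B * (A * w)))) = B * w.
  by rewrite !mulgA AB -!mulgA (mulgA B B) BB mul1g (mulgA A A) AA mul1g.
by rewrite -!mulgA ABABA BB mulg1 !mulgA BC.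
Qed.

End AffineA2.
End LatticeWords.

(** * Groups given by generators and relations *)

Section Evaluation.
Variables (k : nat) (Q : groupType) (g : 'I_k -> Q).

Definition weval (w : word k) : Q := \prod_(x <- w) (if x.2 then (g x.1)^-1 else g x.1).

Lemma weval1 : weval 1%W = 1.
Proof. exact: big_nil. Qed.

Lemma weval_cons x w : weval (x :: w) = (if x.2 then (g x.1)^-1 else g x.1) * weval w.
Proof. exact: big_cons. Qed.

Lemma wevalM u v : weval (u * v)%W = weval u * weval v.
Proof. exact: big_cat. Qed.

Lemma wevalV u : weval (u^-1)%W = (weval u)^-1.
Proof.
elim: u => [|[i b] u IH]; first by rewrite weval1 invg1.
rewrite winv_cons wevalM IH /weval big_seq1 big_cons /= invgM.
by case: b; rewrite ?invgK.
Qed.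

Lemma wevalX2 u : weval (u ^+ 2)%W = weval u ^+ 2.
Proof. by rewrite /wexp /= !wevalM weval1 mulg1 expg2. Qed.

Lemma weval_prod (s : seq nat) (F : nat -> word k) :
  weval (wprod s F) = \prod_(i <- s) weval (F i).
Proof.
elim: s => [|i s IH]; first by rewrite big_nil weval1.
by rewrite big_cons -IH wevalM.
Qed.

Lemma weval_gen i : weval [:: (i, false)] = g i.
Proof. exact: big_seq1. Qed.

Definition satisfies (rels : word k -> word k -> Prop) : Prop :=
  forall u v, rels u v -> weval u = weval v.

End Evaluation.

Section Lift.
Variables (k : nat) (rels : word k -> word k -> Prop).

Lemma weval_pgen w : weval (pgen rels) w = pclass rels w.
Proof.
elim: w => [|[i b] w IH]; first exact: weval1.
rewrite weval_cons IH -[_ :: _]/([:: (i, b)] * w)%W -pmulE /=; congr pmul.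
by case: b => //; apply: pinvE.
Qed.

Lemma pgen_satisfies : satisfies (pgen rels) rels.
Proof. by move=> u v uv; rewrite !weval_pgen; apply/pclassP/wcong_rel. Qed.

Lemma presented_mgen (S : presented rels -> Prop) :
  (forall i, S (pgen rels i) /\ S (pgen rels i)^-1) -> forall x, mgen S x.
Proof.
move=> Sgen x; rewrite -[x]preprK -weval_pgen.
elim: (prepr x) => [|[i b] w IH]; first by rewrite weval1; apply: mgen1.
rewrite weval_cons; apply: mgenM => //=.
by case: (Sgen i); case: b.
Qed.

(** With involutive generators, inverses need not be listed separately. *)
Lemma presented_mgen_invol (S : presented rels -> Prop) :
    (forall i, pgen rels i * pgen rels i = 1) -> (forall i, S (pgen rels i)) ->
  forall x, mgen S x.
Proof.
by move=> sq Sgen; apply: presented_mgen => i; rewrite (mulg1_eq (sq i)); split.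
Qed.

(** The universal property of the presented group: evaluation is invariant under
    the congruence because it is invariant under each of its generating steps. *)
Lemma presented_lift (G : groupType) (g : 'I_k -> G) : satisfies g rels ->
  exists phi : {multiplicative presented rels -> G}, forall i, phi (pgen rels i) = g i.
Proof.
move=> grels.
have gcong u v : wcong rels u v -> weval g u = weval g v.
  elim=> {u v} [//|u v _ -> //|u v w _ -> _ -> //|u u' v v' _ uu' _ vv'|i b|u v].
  - by rewrite !wevalM uu' vv'.
  - by rewrite /weval big_cons big_seq1 big_nil /=; case: b; rewrite ?mulgV ?mulVg.
  - exact: grels.
pose f (x : presented rels) := weval g (prepr x).
have fM : {morph f : x y / x * y}.
  by move=> x y; rewrite /f -wevalM; apply: gcong; apply: wcong_prepr.
pose fmul := isMultiplicative.Build _ _ f fM.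
pose phi : {multiplicative presented rels -> G} := HB.pack f fmul.
exists phi => i; rewrite -[RHS](weval_gen g); apply: gcong; apply: wcong_prepr.
Qed.

End Lift.

(** A presentation is proved by exhibiting reflections g i that satisfy the
    relations and by showing that the induced homomorphism, which is the only one
    sending each generator to g i, is a bijection. *)
Lemma presentation_criterion (K : fieldType) (E : vectType K)
    (P : pred (affine E)) (G : subGroupType P)
    (k : nat) (rels : word k -> word k -> Prop) (g : 'I_k -> G) :
    satisfies g rels -> (forall i, is_reflection (val (g i))) ->
    (forall phi : {multiplicative presented rels -> G},
        (forall i, phi (pgen rels i) = g i) ->
      (forall x, phi x = 1 -> x = 1) /\ (forall y, exists x, phi x = y)) ->
  reflection_presentation G rels.
Proof.
move=> /presented_lift[phi phig] grefl /(_ phi phig)[phi_inj phi_surj].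
exists phi; split=> [|i]; last by rewrite phig.
have /choice[psi psiK] := phi_surj.
by exists psi => // x; apply: (hom_inj phi_inj); rewrite psiK.
Qed.

Lemma presentation_isomorphic (K K' : fieldType) (E : vectType K) (E' : vectType K')
    (P : pred (affine E)) (P' : pred (affine E'))
    (G : subGroupType P) (H : subGroupType P')
    (k : nat) (rels : word k -> word k -> Prop) :
  reflection_presentation G rels -> reflection_presentation H rels -> isomorphic G H.
Proof.
move=> [phi [[psi phiK psiK] _]] [phi' [phi'_bij _]].
have fM : {morph phi' \o psi : x y / x * y}.
  by move=> x y /=; rewrite (can2_gmulfM phiK psiK) gmulfM.
pose fmul := isMultiplicative.Build _ _ (phi' \o psi) fM.
pose f : {multiplicative G -> H} := HB.pack (phi' \o psi) fmul.
exists f; apply: bij_comp phi'_bij _; exact: Bijective psiK phiK.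
Qed.

(** * The relations as equations in a group *)

(** With n + 1 coordinates, a is sigma_1, r j is sigma_(j+2), which exchanges the
    coordinates j and j + 1, and b, c are the last two generators. *)
Record relsG_eqs (Q : groupType) (n : nat) (r : nat -> Q) (a b c : Q) : Prop := RelsGEqs {
  relsG_cox : coxeterA n r;
  relsG_aa : a * a = 1;
  relsG_bb : b * b = 1;
  relsG_cc : c * c = 1;
  relsG_abc : (a * (\prod_(j <- index_iota 0 n) r j) * (b * c)
    * \prod_(j <- downto n 0) r j) ^+ 2 = 1;
  relsG_ar j : 0 < j < n -> commute a (r j);
  relsG_br j : j.+1 < n -> commute b (r j);
  relsG_cr j : j.+1 < n -> commute c (r j);
  relsG_ba : commute b a;
  relsG_ca : commute c a;
  relsG_ar0 : a * r 0 * a * r 0 = r 0 * a * r 0 * a;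
  relsG_brn : b * r n.-1 * b * r n.-1 = r n.-1 * b * r n.-1 * b;
  relsG_crn : c * r n.-1 * c * r n.-1 = r n.-1 * c * r n.-1 * c;
  relsG_bc : r n.-1 * b * (r n.-1)^-1 * c = c * r n.-1 * b * (r n.-1)^-1
}.

Lemma prod_asc (Q : groupType) (F : nat -> Q) k m :
  \prod_(i <- asc k.+1 (k + m)) F i = \prod_(i <- index_iota 0 m) F (k + i).+1.
Proof.
rewrite /asc /index_iota subSS addKn subn0 -[k.+1]addn0 iotaDl big_map.
by apply: eq_bigr => i _; rewrite addSn.
Qed.

Lemma prod_desc (Q : groupType) (F : nat -> Q) k m :
  \prod_(i <- desc (k + m) k.+1) F i = \prod_(i <- downto m 0) F (k + i).+1.
Proof.
rewrite /desc /asc /downto /index_iota subSS addKn subn0 -[k.+1]addn0 iotaDl.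
by rewrite -map_rev big_map; apply: eq_bigr => i _; rewrite addSn.
Qed.

(** Used in both directions: to read the relations in the presented group, and to
    verify them in the group of affine maps. *)
Lemma satisfies_relsG (Q : groupType) n (g : 'I_n.+3 -> Q) : 0 < n ->
  satisfies g (@relsG n.+1) <->
  relsG_eqs n (fun j => g (inord j.+1)) (g (inord 0)) (g (inord n.+1)) (g (inord n.+2)).
Proof.
move=> n_gt0.
have wsig i : weval g (sigma i) = g (inord i.-1) by exact: weval_gen.
have wprod : weval g (((\prod_(i <- asc 1 n.+3) sigma i) * \prod_(i <- desc n.+1 2) sigma i) ^+ 2)%W
    = (g (inord 0) * (\prod_(j <- index_iota 0 n) g (inord j.+1)) *
    (g (inord n.+1) * g (inord n.+2)) * \prod_(j <- downto n 0) g (inord j.+1)) ^+ 2.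
  rewrite wevalX2 wevalM !weval_prod (prod_desc _ 1) (prod_asc _ 0).
  rewrite big_nat_recr //= big_nat_recr //= big_ltn // big_add1 /= !wsig /= !mulgA.
  by congr ((_ * _ * _ * _ * _) ^+ 2); apply: eq_bigr => i _; rewrite wsig.
split=> [H|E].
  have sq i : i < n.+3 -> g (inord i) * g (inord i) = 1.
    move=> ik; have := H _ _ (@relsG_sq n.+1 i.+1 _).
    by rewrite wevalX2 wsig weval1 expg2; apply.
  have comm i j : i < n.+1 -> j < n.+1 -> (i.+1 < j) || (j.+1 < i) ->
      commute (g (inord i)) (g (inord j)).
    move=> ik jk ij; have := H _ _ (@relsG_comm n.+1 i.+1 j.+1 _ _ _).
    by rewrite !wevalM !wsig; apply.
  have comm_end i j : i = n.+1 \/ i = n.+2 -> j < n -> commute (g (inord i)) (g (inord j)).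
    move=> ik jk; have := H _ _ (@relsG_comm_end n.+1 i.+1 j.+1 _ _).
    rewrite !wevalM !wsig; apply=> //.
    by case: ik => ->; rewrite !inE eqxx ?orbT.
  have braid4 i : i = n.+1 \/ i = n.+2 ->
      g (inord i) * g (inord n) * g (inord i) * g (inord n)
      = g (inord n) * g (inord i) * g (inord n) * g (inord i).
    move=> ik; have := H _ _ (@relsG_braid4_end n.+1 i.+1 _).
    rewrite !wevalM !wsig; apply=> //.
    by case: ik => ->; rewrite !inE eqxx ?orbT.
  split; rewrite ?prednK //; try by [apply: sq; lia|apply: comm_end; auto|apply: braid4; auto].
  - split=> [j jn|i j jn ij|j jn]; [by apply: sq; lia|by apply: comm; lia|].
    have := H _ _ (@relsG_braid n.+1 j.+3 j.+2 _ _ _).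
    by rewrite !wevalM !wsig /= => brd; apply/esym/brd; lia.
  - by rewrite -wprod (H _ _ (@relsG_prod n.+1)) weval1.
  - by move=> j jn; apply: comm; lia.
  - by move=> j jn; apply: comm_end; [left|lia].
  - by move=> j jn; apply: comm_end; [right|lia].
  - by have := H _ _ (@relsG_braid4 n.+1); rewrite !wevalM !wsig.
  - by have := H _ _ (@relsG_last n.+1); rewrite !wevalM wevalV !wsig.
case: E => [[sq comm braid] aa bb cc abc ar br cr ba ca ar0 brn crn bc] u v.
rewrite !prednK // in brn crn bc.
case=> {u v}.
- move=> i ik; rewrite wevalX2 weval1 wsig expg2.
  have [->|->|->|[j jn ->]] : [\/ i = 1%N, i = n.+2, i = n.+3 | exists2 j, j < n & i = j.+2] => //.
    have [->|i1] := eqVneq i 1%N; first by constructor 1.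
    have [->|i2] := eqVneq i n.+2; first by constructor 2.
    have [->|i3] := eqVneq i n.+3; first by constructor 3.
    by constructor 4; exists i.-2; lia.
  exact: sq.
- by rewrite wprod abc weval1.
- move=> i j ik jk ij; rewrite !wevalM !wsig.
  wlog {ij} ij : i j ik jk / i.+1 < j.
    by move=> W; case/orP: ij => ij; [apply: W|apply/esym/W].
  case: i ik ij => // [[|i]] ik ij; first by case: j jk ij => // [[|j]] //= jk ij; apply: ar; lia.
  by case: j jk ij => // [[|j]] //= jk ij; apply: comm; lia.
- move=> i j ik jk; rewrite !wevalM !wsig.
  case: j jk => // [[|j]] jk /=; first by move: ik; rewrite !inE => /orP[] /eqP ->.
  by move: ik; rewrite !inE => /orP[] /eqP ->; [apply: br|apply: cr]; lia.
- move=> i j ik jk ij; rewrite !wevalM !wsig ij; move: ij ik; case: j jk => // [[|j]] // jk ij ik /=.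
  by apply/esym/braid; lia.
- by rewrite !wevalM !wsig.
- by move=> i ik; rewrite !wevalM !wsig; move: ik; rewrite !inE => /orP[] /eqP ->.
- by rewrite !wevalM wevalV !wsig.
Qed.

(** With n + 1 coordinates, r j is sigma_(j+1), which exchanges the coordinates j
    and j + 1, and p, q are the last two generators, affine reflections along
    the highest root. *)
Record relsA_eqs (Q : groupType) (n : nat) (r : nat -> Q) (p q : Q) : Prop := RelsAEqs {
  relsA_cox : coxeterA n r;
  relsA_pp : p * p = 1;
  relsA_qq : q * q = 1;
  relsA_pq : ((\prod_(j <- index_iota 0 n) r j) * (p * q) * \prod_(j <- downto n 1) r j) ^+ 2 = 1;
  relsA_pr j : 0 < j < n.-1 -> commute p (r j);
  relsA_qr j : 0 < j < n.-1 -> commute q (r j);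
  relsA_pr0 : p * r 0 * p = r 0 * p * r 0;
  relsA_qr0 : q * r 0 * q = r 0 * q * r 0;
  relsA_prn : p * r n.-1 * p = r n.-1 * p * r n.-1;
  relsA_qrn : q * r n.-1 * q = r n.-1 * q * r n.-1;
  relsA_tied : q * (\prod_(j <- downto n 0) r j) * p * (r 0)^-1
    = r n.-1 * p^-1 * (\prod_(j <- downto n 0) (r j)^-1) * q^-1
}.

Lemma satisfies_relsA (Q : groupType) n (g : 'I_n.+2 -> Q) : 1 < n ->
  satisfies g (@relsA n.+1) <->
  relsA_eqs n (fun j => g (inord j)) (g (inord n)) (g (inord n.+1)).
Proof.
move=> n_gt1.
have wsig i : weval g (sigma i) = g (inord i.-1) by exact: weval_gen.
have wprod : weval g (((\prod_(i <- asc 1 n.+2) sigma i)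
       * \prod_(i <- desc n.+1.-1 2) sigma i) ^+ 2)%W
    = ((\prod_(j <- index_iota 0 n) g (inord j)) *
    (g (inord n) * g (inord n.+1)) * \prod_(j <- downto n 1) g (inord j)) ^+ 2.
  have -> : \prod_(j <- downto n 1) g (inord j) = \prod_(j <- downto n.-1 0) g (inord j.+1).
    rewrite /downto /index_iota subn1 subn0 -[1%N]addn0 iotaDl -map_rev big_map.
    by apply: eq_bigr => i _; rewrite add1n.
  rewrite wevalX2 wevalM !weval_prod (_ : n.+1.-1 = 1 + n.-1)%N; last by lia.
  rewrite (prod_desc _ 1) (prod_asc _ 0).
  rewrite big_nat_recr //= big_nat_recr //= !wsig /= !mulgA.
  by congr ((_ * _ * _ * _) ^+ 2); apply: eq_bigr => i _; rewrite wsig.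
have wtied : (weval g (sigma n.+2 * (\prod_(i <- desc n.+1.-1 1) sigma i) * sigma n.+1
             * (sigma 1)^-1)%W
     = g (inord n.+1) * (\prod_(j <- downto n 0) g (inord j)) * g (inord n) * (g (inord 0))^-1)
  * (weval g (sigma n.+1.-1 * (sigma n.+1)^-1 * (\prod_(i <- desc n.+1.-1 1) (sigma i)^-1)
             * (sigma n.+2)^-1)%W
     = g (inord n.-1) * (g (inord n))^-1 * (\prod_(j <- downto n 0) (g (inord j))^-1)
       * (g (inord n.+1))^-1).
  rewrite !wevalM !wevalV !weval_prod !wsig !(prod_desc _ 0).
  split; congr (_ * _ * _ * _); apply: eq_bigr => i _; by rewrite ?wevalV wsig.
split=> [H|E].
  have sq i : i < n.+2 -> g (inord i) * g (inord i) = 1.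
    move=> ik; have := H _ _ (@relsA_sq n.+1 i.+1 _).
    by rewrite wevalX2 wsig weval1 expg2; apply.
  have comm_end i j : i = n \/ i = n.+1 -> 0 < j < n.-1 -> commute (g (inord i)) (g (inord j)).
    move=> ik jk; have := H _ _ (@relsA_comm_end n.+1 i.+1 j.+1 _ _).
    rewrite !wevalM !wsig; apply; last by lia.
    by case: ik => ->; rewrite !inE eqxx ?orbT.
  have braid i j : i = n \/ i = n.+1 -> j = 0 \/ j = n.-1 ->
      g (inord i) * g (inord j) * g (inord i) = g (inord j) * g (inord i) * g (inord j).
    move=> ik jk; have := H _ _ (@relsA_braid_end n.+1 i.+1 j.+1 _ _).
    rewrite !wevalM !wsig; apply=> //.
      by case: ik => ->; rewrite !inE eqxx ?orbT.
    by case: jk => ->; rewrite !inE ?prednK ?eqxx ?orbT //; lia.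
  split; try by [apply: sq; lia|move=> j jn; apply: comm_end; auto|apply: braid; auto].
  - split=> [j jn|i j jn ij|j jn]; first by apply: sq; lia.
      have := H _ _ (@relsA_comm n.+1 i.+1 j.+1 _ _ _).
      by rewrite !wevalM !wsig; apply; lia.
    have := H _ _ (@relsA_braid n.+1 j.+2 j.+1 _ _ _).
    by rewrite !wevalM !wsig /= => brd; apply/esym/brd; lia.
  - by rewrite -wprod (H _ _ (@relsA_prod n.+1)) weval1.
  - by have := H _ _ (@relsA_last n.+1); rewrite !wtied.
case: E => [[sq comm braid] pp qq pq pr qr pr0 qr0 prn qrn tied] u v.
case=> {u v}.
- move=> i ik; rewrite wevalX2 weval1 wsig expg2.
  have [->|i2] := eqVneq i n.+1 => //.
  have [->|i3] := eqVneq i n.+2 => //.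
  by apply: sq; lia.
- by rewrite wprod pq weval1.
- move=> i j ik jk ij; rewrite !wevalM !wsig.
  wlog {ij} ij : i j ik jk / i.+1 < j.
    by move=> W; case/orP: ij => ij; [apply: W|apply/esym/W].
  by apply: comm; lia.
- move=> i j ik jk; rewrite !wevalM !wsig.
  by move: ik; rewrite !inE => /orP[] /eqP ->; [apply: pr|apply: qr]; lia.
- move=> i j ik jk ij; rewrite !wevalM !wsig ij; case: j jk ij => // j jk ij /=.
  by apply/esym/braid; lia.
- move=> i j ik jk; rewrite !wevalM !wsig.
  by move: ik jk; rewrite !inE => /orP[] /eqP -> /orP[] /eqP ->.
- by rewrite !wtied.
Qed.
Lemma satisfies_rels1 (Q : groupType) (g : 'I_3 -> Q) :
  satisfies g rels1 <->
  [/\ forall i, g i * g i = 1 & (g (inord 0) * g (inord 1) * g (inord 2)) ^+ 2 = 1].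
Proof.
have wsig i : weval g (sigma i) = g (inord i.-1) by exact: weval_gen.
split=> [H|[sq abc] u v].
  split=> [i|]; last by have := H _ _ rels1_prod; rewrite wevalX2 !wevalM !wsig weval1.
  have := H _ _ (@rels1_sq i.+1 (ltn_ord i)).
  by rewrite wevalX2 wsig weval1 inord_val expg2.
case=> [i _|]; rewrite wevalX2 weval1; first by rewrite wsig expg2 sq.
by rewrite !wevalM !wsig.
Qed.

Lemma presented_rels1_normal_form (x : presented rels1) :
  let a := pgen rels1 (inord 0) in
  let b := pgen rels1 (inord 1) in
  let c := pgen rels1 (inord 2) in
  exists k (e : bool), x = (lattice_word (a * b) (a * c) k * a ^+ e).
Proof.
move=> a b c.
have /satisfies_rels1[sq abc] := @pgen_satisfies _ rels1.
apply: (mgen_three_involutions (sq _) (sq _) (sq _) abc).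
apply: presented_mgen_invol => // i.
rewrite -(inord_val i) /a /b /c; case: i => [[|[|[|]]]] //= _; auto.
Qed.

(** * Normal form for the wreath product presentation *)

Section Wreath.
Variables (n : nat) (Q : groupType) (r : nat -> Q) (a b c : Q).
Hypotheses (n_gt0 : 0 < n) (E : relsG_eqs n r a b c).
Variable rho : {multiplicative 'S_n.+1 -> Q}.
Hypothesis rhoE : forall j, j < n -> rho (adj n j) = r j.

(** The copy at coordinate i of a generator that lives at the coordinate base. *)
Definition orbit_of (base : 'I_n.+1) (g : Q) (i : 'I_n.+1) := g ^ rho (tperm base i).

Let F0 : pred 'I_n.+1 := pred0.

Lemma orbit_of_conj base g : (forall s : 'S_n.+1, s base = base -> commute g (rho s)) ->
  forall s i, orbit_of base g i ^ rho s = orbit_of base g (s i).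
Proof.
move=> gs s i; apply: (conj_tperm_orbit (F := F0)) => // t _; exact: gs.
Qed.

Lemma orbit_of_base base g : orbit_of base g base = g.
Proof. by rewrite /orbit_of tperm1 hom1 conjg1. Qed.

(** a commutes with all adjacent transpositions but the first one, and these
    generate the stabiliser of the coordinate 0. *)
Let fix0 (s : 'S_n.+1) : s ord0 = ord0 -> commute a (rho s).
Proof.
move=> s0; apply: (@commute_interval n Q rho 1 n) => [j jn _|i iN].
  by rewrite rhoE; [apply: (relsG_ar E)|]; lia.
suff -> : i = ord0 by [].
by apply: val_inj => /=; have := ltn_ord i; lia.
Qed.

(** b and c live at the last coordinate, for the same reason. *)
Let fixmax g (s : 'S_n.+1) : (forall j, j.+1 < n -> commute g (r j)) ->
  s ord_max = ord_max -> commute g (rho s).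
Proof.
move=> gr s0; apply: (@commute_interval n Q rho 0 n.-1) => [j jn _|i iN].
  by rewrite rhoE; [apply: gr|]; lia.
suff -> : i = ord_max by [].
by apply: val_inj => /=; have := ltn_ord i; lia.
Qed.

Let u := orbit_of ord0 a.
Let v := orbit_of ord_max b.
Let w := orbit_of ord_max c.

Let uJ s i : u i ^ rho s = u (s i). Proof. exact: orbit_of_conj. Qed.
Let vJ s i : v i ^ rho s = v (s i).
Proof. by apply: orbit_of_conj => t; apply: fixmax; apply: (relsG_br E). Qed.
Let wJ s i : w i ^ rho s = w (s i).
Proof. by apply: orbit_of_conj => t; apply: fixmax; apply: (relsG_cr E). Qed.

Let V j : j < n -> (r j)^-1 = r j.
Proof. by move=> jn; apply: mulg1_eq; case: (relsG_cox E) => sq _ _; apply: sq. Qed.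

(** With r j an involution, a braid relation of length four is a commutation. *)
Let comm4 g j : j < n -> g * r j * g * r j = r j * g * r j * g -> commute g (g ^ r j).
Proof. by move=> jn H; rewrite /commute conjgE V // !mulgA. Qed.

Let ord1 : 'I_n.+1 := inord 1.
Let pre : 'I_n.+1 := inord n.-1.

Let adj0 : adj n 0 ord0 = ord1.
Proof. by apply: val_inj; rewrite /= adjE // inordK. Qed.

Let adjmax : adj n n.-1 ord_max = pre.
Proof. by apply: val_inj; rewrite /= adjE; rewrite ?inordK /=; do ?case: ifP; lia. Qed.

Let max0 : ord_max != ord0 :> 'I_n.+1.
Proof. by rewrite -val_eqE /=; lia. Qed.
Let maxpre : ord_max != pre.
Proof. by rewrite -val_eqE /= inordK; lia. Qed.

(** In the six lemmas that follow, one relation of the presentation provides the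
    commutation for one pair of distinct coordinates. *)
Let comm_uu i j : i != j -> commute (u i) (u j).
Proof.
apply: (commute_transport (rho := rho) (F := F0) (i := ord0) (j := ord1)) => //.
  by rewrite -val_eqE /= inordK.
rewrite -adj0 -uJ rhoE // /u orbit_of_base; apply: comm4 => //.
exact: (relsG_ar0 E).
Qed.

Let comm_vv i j : i != j -> commute (v i) (v j).
Proof.
apply: (commute_transport (rho := rho) (F := F0) (i := ord_max) (j := pre)) => //.
rewrite -adjmax -vJ rhoE; last lia.
rewrite /v orbit_of_base; apply: comm4; [lia|exact: (relsG_brn E)].
Qed.

Let comm_ww i j : i != j -> commute (w i) (w j).
Proof.
apply: (commute_transport (rho := rho) (F := F0) (i := ord_max) (j := pre)) => //.
rewrite -adjmax -wJ rhoE; last lia.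
rewrite /w orbit_of_base; apply: comm4; [lia|exact: (relsG_crn E)].
Qed.

Let comm_vu i j : i != j -> commute (v i) (u j).
Proof.
apply: (commute_transport (rho := rho) (F := F0) (i := ord_max) (j := ord0)) => //.
by rewrite /u /v !orbit_of_base; apply: (relsG_ba E).
Qed.

Let comm_wu i j : i != j -> commute (w i) (u j).
Proof.
apply: (commute_transport (rho := rho) (F := F0) (i := ord_max) (j := ord0)) => //.
by rewrite /u /w !orbit_of_base; apply: (relsG_ca E).
Qed.

Let comm_wv i j : i != j -> commute (w i) (v j).
Proof.
apply: (commute_transport (rho := rho) (F := F0) (i := ord_max) (j := pre)) => //.
rewrite -adjmax -vJ rhoE; last lia.
rewrite /v /w !orbit_of_base /commute conjgE V; last lia.
by have := relsG_bc E; rewrite V ?mulgA; last lia.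
Qed.

(** The descending product of the r j moves the last coordinate to 0, so the long
    product relation is about a and the copies of b and c at coordinate 0. *)
Let uvw i : (u i * v i * w i) ^+ 2 = 1.
Proof.
have uvw0 : (u ord0 * v ord0 * w ord0) ^+ 2 = 1.
  have cox := relsG_cox E.
  pose d : 'S_n.+1 := \prod_(j <- downto n 0) adj n j.
  have d0 : d ord_max = ord0.
    by apply: val_inj; rewrite /= prod_adj_downto ?leqnn // eqxx.
  have := relsG_abc E; rewrite (rho_upto rhoE) // -(rho_downto rhoE) -/d.
  have -> : a * (rho d)^-1 * (b * c) * rho d = a * (b * c) ^ rho d.
    by rewrite conjgE !mulgA.
  rewrite conjMg mulgA -d0 -vJ -wJ {1}d0.
  by rewrite /u /v /w !orbit_of_base.
by rewrite -(tpermL ord0 i) -uJ -vJ -wJ -!conjMg -conjXg uvw0 conj1g.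
Qed.

(** A group generated by elements that satisfy the relations is thus a quotient of
    the wreath product. *)
Lemma wreath_normal_form x :
    mgen (fun g => [\/ exists2 j, j < n & g = r j, g = a, g = b | g = c]) x ->
  exists (k : 'I_n.+1 -> int * int) (e : 'I_n.+1 -> bool) (s : 'S_n.+1),
    x = (\prod_i (lattice_word (u i * v i) (u i * w i) (k i) * u i ^+ e i)) * rho s.
Proof.
pose U i g := g = u i \/ g = v i \/ g = w i.
have Ucomm i j g h : i != j -> U i g -> U j h -> commute g h.
  move=> ij; have ji : j != i by rewrite eq_sym.
  by case=> [|[]] -> [|[]] ->; auto; apply/commute_sym; auto.
have Uconj i g s : U i g -> prod_of U (g ^ rho s).
  move=> Ug; apply: (prod_of_in (i := s i)); apply: mgen_in.
  by case: Ug => [|[]] ->; rewrite /U ?uJ ?vJ ?wJ; auto.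
move=> /(mgen_sub (S' := fun y => (exists s, y = rho s) \/ exists i, U i y)) H.
have {H} [|g [s [gU ->]]] := factorization Ucomm Uconj (H _).
  move=> g gS; apply: mgen_in; case: gS => [[j jn ->]|->|->|->].
  - by left; exists (adj n j); rewrite rhoE.
  - by right; exists ord0; left; rewrite /u orbit_of_base.
  - by right; exists ord_max; right; left; rewrite /v orbit_of_base.
  - by right; exists ord_max; right; right; rewrite /w orbit_of_base.
have nf i : exists ke : (int * int) * bool,
    g i = lattice_word (u i * v i) (u i * w i) ke.1 * u i ^+ ke.2.
  have sqr h : h * h = 1 -> forall t, h ^ rho t * h ^ rho t = 1.
    by move=> hh t; rewrite -conjMg hh conj1g.
  have [k [e ->]] := mgen_three_involutions (sqr _ (relsG_aa E) _)
    (sqr _ (relsG_bb E) _) (sqr _ (relsG_cc E) _) (uvw i) (gU i).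
  by exists (k, e).
have [ke keE] := choice nf.
exists (fun i => (ke i).1), (fun i => (ke i).2), s.
by congr (_ * _); apply: eq_bigr => i _; apply: keE.
Qed.

End Wreath.

(** * Normal form for the affine symmetric presentation *)

(** The relations between the r j and one affine reflection p are those of the
    affine Coxeter group of type A; here they are shown to produce translations
    that form a quotient of the root lattice. *)
Section RootLattice.
Variables (n : nat) (Q : groupType) (r : nat -> Q) (p : Q).
Hypotheses (n_gt1 : 1 < n) (cox : coxeterA n r) (pp : p * p = 1).
Hypothesis pr : forall j, 0 < j < n.-1 -> commute p (r j).
Hypothesis pr0 : p * r 0 * p = r 0 * p * r 0.
Hypothesis prn : p * r n.-1 * p = r n.-1 * p * r n.-1.
Variable rho : {multiplicative 'S_n.+1 -> Q}.
Hypothesis rhoE : forall j, j < n -> rho (adj n j) = r j.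

Let one : 'I_n.+1 := inord 1.
Let pre : 'I_n.+1 := inord n.-1.

Let oneE : one = 1%N :> nat. Proof. by rewrite inordK; lia. Qed.
Let preE : pre = n.-1 :> nat. Proof. by rewrite inordK; lia. Qed.

(** p commutes with the adjacent transpositions that avoid both end points, as it
    should for a reflection along the root of the two end points. *)
Let p_fix (s : 'S_n.+1) : s ord0 = ord0 -> s ord_max = ord_max -> commute p (rho s).
Proof.
move=> s0 sm; apply: (@commute_interval n Q rho 1 n.-1) => [j jn _|i iN].
  by rewrite rhoE; [apply: pr|]; lia.
have [->//|i0] := eqVneq i ord0; have [->//|im] := eqVneq i ord_max.
move: i0 im; rewrite -!val_eqE /=; have := ltn_ord i; lia.
Qed.

Let theta : 'S_n.+1 := tperm ord0 ord_max.

(** The translation along the root e_0 - e_i; its value at 0 is 1, so that the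
    formula [root_translation_conj] needs no case distinction. *)
Definition root_translation (i : 'I_n.+1) : Q :=
  if i == ord0 then 1 else (p * rho theta) ^ rho (tperm ord_max i).

Let x := root_translation.
Let F : pred 'I_n.+1 := pred1 ord0.

Let max0 : ord_max != ord0 :> 'I_n.+1.
Proof. by rewrite -val_eqE /=; lia. Qed.
Let one0 : one != ord0. Proof. by rewrite -val_eqE /= oneE. Qed.
Let onemax : one != ord_max. Proof. by rewrite -val_eqE /= oneE; lia. Qed.

Let base_fix (s : 'S_n.+1) : {in F, forall k, s k = k} -> s ord_max = ord_max ->
  commute (p * rho theta) (rho s).
Proof.
move=> sF sm; have s0 : s ord0 = ord0 by apply: sF; apply/eqP.
apply/commute_sym/commuteM; first exact/commute_sym/p_fix.
by rewrite /commute -!gmulfM (conjgC theta) tpermJ s0 sm.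
Qed.

Let x0 : x ord0 = 1. Proof. by rewrite /x /root_translation eqxx. Qed.

Lemma root_translation_conj0 (s : 'S_n.+1) i : {in F, forall k, s k = k} -> i \notin F ->
  x i ^ rho s = x (s i).
Proof.
move=> sF; rewrite inE => /negPf iF.
have siF : (s i == ord0) = false.
  by rewrite -(sF ord0 (eqxx _)) (inj_eq perm_inj).
rewrite /x /root_translation iF siF.
by apply: (conj_tperm_orbit base_fix) => //; rewrite inE ?iF.
Qed.

Lemma root_translation_max : x ord_max = p * rho theta.
Proof. by rewrite /x /root_translation (negPf max0) tperm1 hom1 conjg1. Qed.

(** A, B and p are reflections along e_1 - e_max, e_0 - e_1 and e_0 - e_max, and
    satisfy the hypotheses of the rank two computation. *)
Let A := rho (tperm one ord_max).
Let B := rho (tperm ord0 one).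

Let rho_sq s t : rho (tperm s t) * rho (tperm s t) = 1.
Proof. by rewrite -gmulfM tperm2 hom1. Qed.
Let rho_V s t : (rho (tperm s t))^-1 = rho (tperm s t).
Proof. by apply: mulg1_eq; apply: rho_sq. Qed.

Let BE : B = r 0.
Proof.
rewrite -rhoE; last lia.
by congr (rho (tperm _ _)); apply: val_inj; rewrite /= inordK.
Qed.

Let AB : A * B * A = B * A * B.
Proof.
rewrite -!gmulfM; congr (rho _).
rewrite -{1}(tpermV one ord_max) -mulgA -conjgE tpermJ.
rewrite -{1}(tpermV ord0 one) -mulgA -conjgE tpermJ.
by rewrite !tpermL !tpermR ?tpermD // eq_sym.
Qed.

Let BC : B * p * B = p * B * p. Proof. by rewrite BE pr0. Qed.

(** The given braid relation is between p and r n.-1, which exchanges the last two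
    coordinates; it is conjugated by a permutation that fixes both end points and
    moves the coordinate n.-1 to 1. *)
Let AC : A * p * A = p * A * p.
Proof.
pose t := tperm one pre.
have t0 : t ord0 = ord0.
  by rewrite tpermD // -val_eqE /= preE; lia.
have tm : t ord_max = ord_max.
  by rewrite tpermD // -val_eqE /= preE; lia.
have pt : p ^ rho t = p by rewrite conjgE (p_fix t0 tm) mulKg.
have At : r n.-1 ^ rho t = A.
  rewrite -rhoE; last lia.
  rewrite -homJ /adj tpermJ prednK; last lia.
  have -> : inord n = ord_max :> 'I_n.+1 by apply: val_inj; rewrite /= inordK.
  by rewrite tm tpermR.
by rewrite -At -pt -!conjMg prn.
Qed.

Let xmaxE : x ord_max = p * A * B * A.
Proof.
rewrite root_translation_max -!mulgA; congr (_ * _); rewrite -!gmulfM; congr (rho _).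
rewrite -{1}(tpermV one ord_max) -conjgE tpermJ.
by rewrite tpermL tpermD.
Qed.

Let xoneE : x one = A * p * A * B.
Proof.
have -> : x one = x ord_max ^ A.
  rewrite root_translation_conj0 ?inE ?tpermR //.
  by move=> k; rewrite inE => /eqP ->; rewrite tpermD.
by rewrite xmaxE conjgE /A rho_V -/A -!mulgA rho_sq mulg1.
Qed.

(** The pair (1, max) is [affineA2_commute]; all others are conjugate to it. *)
Lemma root_translation_commute i j : commute (x i) (x j).
Proof.
have [->|i0] := eqVneq i ord0; first by rewrite x0; apply/commute_sym/commute1.
have [->|j0] := eqVneq j ord0; first by rewrite x0; apply/commute1.
have [->|ij] := eqVneq i j; first exact: commute_refl.
apply: (commute_transport root_translation_conj0 root_translation_conj0 _ _ onemax) => //.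
by rewrite xoneE xmaxE; apply: affineA2_commute => //; apply: rho_sq.
Qed.

(** The only adjacent transposition that moves the coordinate 0. For i = max this
    is [affineA2_conj], and every i other than 0 and 1 is conjugate to it under
    permutations that commute with r 0. *)
Let x_r0 i : x i ^ r 0 = (x one)^-1 * x (tperm ord0 one i).
Proof.
have A2 : x ord_max ^ r 0 = x ord_max * (x one)^-1.
  by rewrite -BE xmaxE xoneE; apply: affineA2_conj => //; apply: rho_sq.
have [->|i0] := eqVneq i ord0; first by rewrite x0 conj1g tpermL mulVg.
have [->|i1] := eqVneq i one.
  rewrite tpermR x0 mulg1 xoneE -BE conjgE !invgM /A /B !rho_V -/A -/B (mulg1_eq pp).
  by rewrite -!mulgA rho_sq mulg1.
rewrite tpermD 1?eq_sym //.
pose t := tperm ord_max i.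
have t0 : {in F, forall k, t k = k}.
  by move=> k; rewrite inE => /eqP ->; rewrite tpermD.
have t1 : t one = one by rewrite tpermD // eq_sym.
have xi : x i = x ord_max ^ rho t by rewrite root_translation_conj0 ?inE ?tpermL.
have rt : commute (rho t) (r 0).
  rewrite -BE /B /commute -!gmulfM; congr (rho _).
  by rewrite (conjgC (tperm ord0 one)) tpermJ t1 t0 // inE.
rewrite {1}xi -conjgM rt conjgM A2 conjMg -xi conjVg root_translation_conj0 ?inE // t1.
by apply/commute_sym/commute_sym/commuteV/root_translation_commute.
Qed.

(** Conjugation maps e_0 - e_i to e_(s 0) - e_(s i), which is written in the basis
    as (e_0 - e_(s i)) - (e_0 - e_(s 0)). The formula is multiplicative in s, so
    it suffices to check it on adjacent transpositions. *)
Lemma root_translation_conj (s : 'S_n.+1) i :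
  x i ^ rho s = (x (s ord0))^-1 * x (s i).
Proof.
move: i; pose Pr (s : 'S_n.+1) := forall i, x i ^ rho s = (x (s ord0))^-1 * x (s i).
suff: Pr s by []; apply: (@tperm_interval_ind n 0 n Pr) => [|{}s t IHs IHt|j _ jn|] i.
- by rewrite hom1 conjg1 !perm1 x0 invg1 mul1g.
- rewrite gmulfM conjgM IHs conjMg conjVg !IHt !permM invgM invgK.
  by rewrite -!mulgA mulVKg.
- rewrite rhoE //; case: j jn => [|j] jn.
    rewrite x_r0 /adj (_ : inord 0 = ord0) ?tpermL //.
    by apply: val_inj; rewrite /= inordK.
  rewrite -rhoE //.
  have a0 : adj n j.+1 ord0 = ord0.
    by apply: val_inj; rewrite /= adjE.
  have [->|i0] := eqVneq i ord0; first by rewrite x0 conj1g mulVg.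
  rewrite a0 x0 invg1 mul1g root_translation_conj0 // ?inE // => k.
  by rewrite inE => /eqP ->.
- by have := ltn_ord i; lia.
Qed.

End RootLattice.

Section AffineSymmetric.
Variables (n : nat) (Q : groupType) (r : nat -> Q) (p q : Q).
Hypotheses (n_gt1 : 1 < n) (E : relsA_eqs n r p q).
Variable rho : {multiplicative 'S_n.+1 -> Q}.
Hypothesis rhoE : forall j, j < n -> rho (adj n j) = r j.

Let x := root_translation p rho.
Let y := root_translation q rho.
Let F : pred 'I_n.+1 := pred1 ord0.

Let xJ s i : x i ^ rho s = (x (s ord0))^-1 * x (s i).
Proof. by case: E => *; apply: (root_translation_conj (r := r)). Qed.
Let yJ s i : y i ^ rho s = (y (s ord0))^-1 * y (s i).
Proof. by case: E => *; apply: (root_translation_conj (r := r)). Qed.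
Let x0 : x ord0 = 1. Proof. by rewrite /x /root_translation eqxx. Qed.
Let y0 : y ord0 = 1. Proof. by rewrite /y /root_translation eqxx. Qed.

Let theta : 'S_n.+1 := tperm ord0 ord_max.
Let pre : 'I_n.+1 := inord n.-1.
Let preE : pre = n.-1 :> nat. Proof. by rewrite inordK; lia. Qed.
Let max0 : ord_max != ord0 :> 'I_n.+1. Proof. by rewrite -val_eqE /=; lia. Qed.
Let pre0 : pre != ord0. Proof. by rewrite -val_eqE /= preE; lia. Qed.
Let premax : pre != ord_max. Proof. by rewrite -val_eqE /= preE; lia. Qed.

Let xmaxE : x ord_max = p * rho theta.
Proof. by case: E => *; apply: root_translation_max. Qed.
Let ymaxE : y ord_max = q * rho theta.
Proof. by case: E => *; apply: root_translation_max. Qed.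

Let thetaV : (rho theta)^-1 = rho theta.
Proof. by rewrite -homV tpermV. Qed.

(** Substitute p = x_max theta and q = y_max theta in the last relation and move
    the translations to the left. The permutation parts of both sides agree by
    [descending_cycle_relation], and what remains is y_max x_pre = x_pre y_max. *)
Let comm_max : commute (y ord_max) (x pre).
Proof.
have [sq _ _] := relsA_cox E.
have rV j : j < n -> (r j)^-1 = r j by move=> jn; apply: mulg1_eq; apply: sq.
pose d : 'S_n.+1 := \prod_(j <- downto n 0) adj n j.
have dE : rho d = \prod_(j <- downto n 0) r j := rho_downto rhoE 0.
have dV : \prod_(j <- downto n 0) (r j)^-1 = rho d.
  rewrite dE big_seq [RHS]big_seq; apply: eq_bigr => j.
  by rewrite mem_downto => jn; apply: rV.
have dv := @descending_cycleE n; rewrite -/d in dv.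
pose t := adj n n.-1.
have pE : p = x ord_max * rho theta by rewrite xmaxE -mulgA -{2}thetaV mulgV mulg1.
have qE : q = y ord_max * rho theta by rewrite ymaxE -mulgA -{2}thetaV mulgV mulg1.
have pV : p^-1 = p by apply: mulg1_eq; apply: (relsA_pp E).
have qV : q^-1 = q by apply: mulg1_eq; apply: (relsA_qq E).
have := relsA_tied E; rewrite dV -dE pV qV rV; last lia.
rewrite -(rhoE (j := n.-1)); last lia.
rewrite -(rhoE (j := 0)); last lia.
rewrite pE qE -/t.
have thE := @tperm_endsE n; rewrite -/theta in thE.
have moveL (g h : Q) : h * g = g ^ h^-1 * h by rewrite -conjgCV.
set s1 := (theta * d)^-1; set s2 := (t * theta * d)^-1.
have s10 : s1 ord0 = ord0.
  apply: (@perm_inj _ (theta * d)); rewrite permKV permM; apply: val_inj => /=.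
  by rewrite dv thE eqxx.
have s1m : s1 ord_max = pre.
  apply: (@perm_inj _ (theta * d)); rewrite permKV permM; apply: val_inj => /=.
  by rewrite dv thE preE; do !case: ifP; lia.
have s20 : s2 ord0 = ord0.
  apply: (@perm_inj _ (t * theta * d)); rewrite permKV !permM; apply: val_inj => /=.
  by rewrite dv thE adjE /=; do ?case: ifP; lia.
have s2m : s2 ord_max = ord_max.
  apply: (@perm_inj _ (t * theta * d)); rewrite permKV !permM; apply: val_inj => /=.
  by rewrite dv thE adjE /=; do ?case: ifP; lia.
have t0 : t^-1 ord0 = ord0.
  apply: (@perm_inj _ t); rewrite permKV; apply: val_inj => /=.
  by rewrite adjE /=; do ?case: ifP; lia.
have tm : t^-1 ord_max = pre.
  apply: (@perm_inj _ t); rewrite permKV; apply: val_inj => /=.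
  by rewrite adjE ?preE /=; do ?case: ifP; lia.
have cyc : theta * d * theta * adj n 0 = t * theta * d * theta by exact: descending_cycle_relation.
have -> : y ord_max * rho theta * rho d * (x ord_max * rho theta) * rho (adj n 0) =
    y ord_max * x pre * rho (theta * d * theta * adj n 0).
  rewrite !gmulfM -!mulgA; congr (_ * _).
  rewrite !mulgA -gmulfM (moveL (x _) (rho (theta * d))) -homV -/s1 xJ s10 s1m x0 invg1 mul1g.
  by rewrite gmulfM -!mulgA.
have -> : rho t * (x ord_max * rho theta) * rho d * (y ord_max * rho theta) =
    x pre * y ord_max * rho (t * theta * d * theta).
  rewrite !mulgA (moveL (x _) (rho t)) -homV xJ t0 tm x0 invg1 mul1g -!mulgA; congr (_ * _).
  rewrite !mulgA -2!gmulfM (moveL (y _) (rho (t * theta * d))) -homV -/s2 yJ s20 s2m y0 invg1 mul1g.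
  by rewrite -!mulgA -!gmulfM !mulgA.
by rewrite cyc => /mulIg.
Qed.

Let xJ0 (s : 'S_n.+1) k : {in F, forall i, s i = i} -> k \notin F -> x k ^ rho s = x (s k).
Proof. by move=> sF _; rewrite xJ sF ?inE // x0 invg1 mul1g. Qed.
Let yJ0 (s : 'S_n.+1) k : {in F, forall i, s i = i} -> k \notin F -> y k ^ rho s = y (s k).
Proof. by move=> sF _; rewrite yJ sF ?inE // y0 invg1 mul1g. Qed.

Let comm_neq i j : j != ord0 -> i != j -> commute (x i) (y j).
Proof.
move=> j0 ij; have [->|i0] := eqVneq i ord0; first by rewrite x0; apply/commute_sym/commute1.
by apply: (commute_transport xJ0 yJ0 _ _ premax (commute_sym comm_max)).
Qed.

(** For i = j, conjugate the commutation of x_j and y_k by the transposition of 0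
    and j: it becomes that of x_j^-1 and y_j^-1 y_k, and y_k already commutes
    with x_j. *)
Let comm_xy i j : commute (x i) (y j).
Proof.
have [->|j0] := eqVneq j ord0; first by rewrite y0; apply/commute1.
have [->|ij] := eqVneq i j; last exact: comm_neq.
have [k k0 kj] : exists2 k : 'I_n.+1, k != ord0 & j != k.
  by have [->|jm] := eqVneq j ord_max; [exists pre|exists ord_max]; rewrite // eq_sym.
have := comm_neq k0 kj; have [] := (xJ (tperm ord0 j) j, yJ (tperm ord0 j) k).
rewrite tpermL tpermR (tpermD _ kj) 1?eq_sym // x0 mulg1 => xj yk xy.
have : commute (x j)^-1 ((y j)^-1 * y k).
  by rewrite -xj -yk /commute -!conjMg xy.
move/commute_sym/commuteV; rewrite invgK => /commute_sym H.
have := commuteM xy (commuteV H); rewrite invgM invgK mulVKg.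
exact.
Qed.

(** A group generated by elements that satisfy the relations is thus a quotient of
    the semidirect product of the symmetric group with two copies of the root
    lattice. *)
Lemma affine_symmetric_normal_form g :
    mgen (fun g => [\/ exists2 j, j < n & g = r j, g = p | g = q]) g ->
  exists (k : 'I_n.+1 -> int * int) (s : 'S_n.+1),
    g = (\prod_i lattice_word (x i) (y i) (k i)) * rho s.
Proof.
pose U i h := h = x i \/ h = (x i)^-1 \/ h = y i \/ h = (y i)^-1.
have xx i j : commute (x i) (x j) by case: E => *; apply: (root_translation_commute (r := r)).
have yy i j : commute (y i) (y j) by case: E => *; apply: (root_translation_commute (r := r)).
have VL (a b : Q) : commute a b -> commute a^-1 b.
  by move=> ab; apply/commute_sym/commuteV/commute_sym.
have Ucomm i j a b : i != j -> U i a -> U j b -> commute a b.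
  have yx : commute (y i) (x j) by apply: commute_sym.
  by move=> _ [|[|[|]]] -> [|[|[|]]] ->; try (apply: VL); try (apply: commuteV).
have inU i h : U i h -> prod_of U h by move=> Uh; apply/(prod_of_in (i := i))/mgen_in.
have Uconj i h s : U i h -> prod_of U (h ^ rho s).
  have UV k a : U k a -> U k a^-1 by case=> [|[|[|]]] ->; rewrite /U ?invgK; auto.
  have Ux k : prod_of U (x k) by apply: (inU k); left.
  have UVx k : prod_of U (x k)^-1 by apply: (inU k); right; left.
  have Uy k : prod_of U (y k) by apply: (inU k); right; right; left.
  have UVy k : prod_of U (y k)^-1 by apply: (inU k); right; right; right.
  case=> [|[|[|]]] ->; rewrite ?conjVg ?xJ ?yJ ?invgM ?invgK;
    exact: prod_ofM.
move=> /(mgen_sub (S' := fun y => (exists s, y = rho s) \/ exists i, U i y)) H.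
have {H} [|h [s [hU ->]]] := factorization Ucomm Uconj (H _).
  have th : mgen (fun y => (exists s, y = rho s) \/ exists i, U i y) (rho theta).
    by apply: mgen_in; left; exists theta.
  have thth : rho theta * rho theta = 1 by rewrite -{2}thetaV mulgV.
  move=> h [[j jn ->]|->|->].
  - by apply: mgen_in; left; exists (adj n j); rewrite rhoE.
  - have -> : p = x ord_max * rho theta by rewrite xmaxE -mulgA thth mulg1.
    by apply: mgenM => //; right; exists ord_max; left.
  - have -> : q = y ord_max * rho theta by rewrite ymaxE -mulgA thth mulg1.
    by apply: mgenM => //; right; exists ord_max; right; right; left.
have nf i : exists k, h i = lattice_word (x i) (y i) k.
  by apply: mgen_lattice_word; [apply: comm_xy|apply: hU].
have [k kE] := choice nf.
by exists k, s; congr (_ * _); apply: eq_bigr => i _; apply: kE.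
Qed.

End AffineSymmetric.

Local Close Scope group_scope.
Local Open Scope ring_scope.
Import Order.TTheory GRing.Theory Num.Theory.

(** * Affine maps, reflections and translations *)

Section GenericAffine.
Variables (K : fieldType) (E : vectType K).
Local Open Scope ring_scope.
Import GRing.Theory.

(** A map z |-> z - (l z - c) v with l v = 2 is an involution, and it fixes the
    affine hyperplane l z = c pointwise; (c / 2) v is a point of it. *)
Lemma is_reflectionP (f : affine E) (l : E -> K) (v : E) (c : K) :
    (2 : K) != 0 -> (forall a x y, l (a *: x + y) = a * l x + l y) -> l v = 2 ->
    (forall z, aff_fun f z = z - (l z - c) *: v) -> is_reflection f.
Proof.
move=> two llin lv fE.
have llin' : linear (l : E -> K^o) by exact: llin.
pose lmul := GRing.isLinear.Build _ _ _ _ _ llin'.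
pose L : {linear E -> K^o} := HB.pack (l : E -> K^o) lmul.
have l0 : l 0 = 0 by exact: (linear0 L).
have lZ a x : l (a *: x) = a * l x by exact: (linearZ_LR L).
have lB x y : l (x - y) = l x - l y by exact: (linearB L).
have lD x y : l (x + y) = l x + l y by exact: (linearD L).
have v0 : v != 0 by apply: contraNneq two => v0; rewrite -lv v0 l0.
split.
- move=> f1; have fz z : l z = c.
    have := fE z; rewrite f1 aff_oneE => /eqP; rewrite eq_sym addrC -subr_eq0 addrK oppr_eq0.
    by rewrite scaler_eq0 (negPf v0) orbF subr_eq0 => /eqP.
  by move/eqP: two; apply; rewrite -lv fz -(fz 0) l0.
- exists 2%N => //; apply: aff_funP => z; rewrite expg2 aff_mulE aff_oneE !fE.
  rewrite lB lZ lv (_ : l z - (l z - c) * 2 - c = - (l z - c)); last by ring.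
  by rewrite scaleNr opprK subrK.
- exists ((c / 2) *: v), (lker (linfun L)); split.
    have := limg_ker_dim (linfun L) fullv; rewrite capfv => <-.
    suff -> : \dim (limg (linfun L)) = 1%N by rewrite addn1.
    apply/eqP; rewrite eqn_leq; apply/andP; split.
      by apply: leq_trans (dimvS (subvf _)) _; rewrite dimvf /dim /= ?muln1.
    rewrite lt0n dimv_eq0; apply: contraNneq two => im0.
    have : linfun L v \in limg (linfun L) by rewrite memv_img ?memvf.
    by rewrite im0 memv0 lfunE /= lv.
  move=> u; rewrite memv_ker lfunE /= => /eqP lu.
  by rewrite fE lD lZ lv lu addr0 divfK // subrr scale0r subr0.
Qed.

Variables (P : pred (affine E)) (G : subGroupType P).
Implicit Types f g : G.

(** The action on points, kept opaque: comparing two elements of the group must not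
    unfold them into linear maps and matrices. *)
Lemma act_sig : {a : G -> E -> E | forall f z, a f z = aff_fun (val f) z}.
Proof. by exists (fun f => aff_fun (val f)). Qed.

Definition act : G -> E -> E := sval act_sig.

Lemma actE f z : act f z = aff_fun (val f) z.
Proof. exact: (svalP act_sig). Qed.

Lemma actM f g z : act (f * g)%g z = act f (act g z).
Proof. by rewrite !actE valM aff_mulE. Qed.

Lemma act1 z : act 1%g z = z.
Proof. by rewrite actE val1 aff_oneE. Qed.

Lemma act_inj f g : (forall z, act f z = act g z) -> f = g.
Proof.
by move=> fg; apply: val_inj; apply: aff_funP => z; rewrite -!actE.
Qed.

Definition translates f (t : E) := forall z, act f z = z + t.

Lemma translates1 : translates 1%g 0.
Proof. by move=> z; rewrite act1 addr0. Qed.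

Lemma translatesM f g t u : translates f t -> translates g u -> translates (f * g)%g (t + u).
Proof. by move=> ft gu z; rewrite actM ft gu -addrA (addrC u). Qed.

Lemma translatesV f t : translates f t -> translates (f^-1)%g (- t).
Proof.
move=> ft z; rewrite -{2}[z]act1 -(mulgV f) actM ft.
by rewrite addrK.
Qed.

Lemma translates_expgz f t m : translates f t -> translates (expgz f m) (t *~ m).
Proof.
have tX k : translates f t -> translates (f ^+ k)%g (t *+ k).
  move=> ft; elim: k => [|k IH]; first by rewrite mulr0n; apply: translates1.
  by rewrite expgS mulrS; apply: translatesM.
by case: m => m ft /=; [|apply: translatesV]; apply: tX.
Qed.

Lemma translates_lattice_word f g t u k : translates f t -> translates g u ->
  translates (lattice_word f g k) (t *~ k.1 + u *~ k.2).
Proof. by move=> ft gu; apply: translatesM; apply: translates_expgz. Qed.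

Lemma translates_prod (I : Type) (l : seq I) (f : I -> G) (t : I -> E) :
  (forall i, translates (f i) (t i)) -> translates (\prod_(i <- l) f i)%g (\sum_(i <- l) t i).
Proof.
move=> ft; elim: l => [|i l IH]; first by rewrite !big_nil; apply: translates1.
by rewrite !big_cons; apply: translatesM.
Qed.

End GenericAffine.

(** * The groups of type G(2,1,n) *)

Section SignedPermutations.
Variables (R : realType) (alpha : R[i]) (n : nat).
Local Open Scope ring_scope.
Import Order.TTheory GRing.Theory Num.Theory.
Local Notation V := 'cV[R[i]]_n.+1.
Local Notation G := (G21 n.+1 alpha).

Lemma G21_elt_exists (eps : 'I_n.+1 -> bool) (s : 'S_n.+1) (t : V) :
    (forall i, in_lattice alpha (t i 0)) ->
  exists f : G, forall z i, act f z i 0 = (-1) ^+ eps i * z (s i) 0 + t i 0.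
Proof.
move=> tP; pose L := linfun (mulmx (signed_perm_mx R eps s) : V -> V).
have LE z i : L z i 0 = (-1) ^+ eps i * z (s i) 0.
  by rewrite lfunE /= mul_signed_perm_mx.
have Linj : lker L == 0%VS.
  apply/lker0P => u v uv; apply/colP => i.
  have := congr1 (fun w : V => w (s^-1%g i) 0) uv.
  by rewrite !LE permKV; apply: mulfI; rewrite signr_eq0.
pose f : affine V := exist _ (L, t) Linj.
have fE z i : aff_fun f z i 0 = (-1) ^+ eps i * z (s i) 0 + t i 0.
  by rewrite /aff_fun mxE LE.
have fP : G21_pred alpha f.
  apply/asboolP; exists eps, s, t; split=> // z.
  by apply/colP => i; rewrite [LHS]fE mxE mul_signed_perm_mx.
by exists (exist _ f fP) => z i; rewrite actE.
Qed.

Lemma G21_inj (f g : G) :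
  (forall z i, act f z i 0 = act g z i 0) -> f = g.
Proof. by move=> fg; apply: act_inj => z; apply/colP => i; apply: fg. Qed.

(** Here and below, the elements of the group that are computed with are known only
    by their action on coordinates. *)
Lemma permG_sig (s : 'S_n.+1) : {f : G | forall z i, act f z i 0 = z (s i) 0}.
Proof.
apply: cid; have [|f fE] := @G21_elt_exists (fun=> false) s 0.
  by move=> i; rewrite mxE; apply: in_lattice0.
by exists f => z i; rewrite fE mul1r mxE addr0.
Qed.

Definition permG_fun (s : 'S_n.+1) : G := sval (permG_sig s).

Lemma permG_funE s z i : act (permG_fun s) z i 0 = z (s i) 0.
Proof. exact: (svalP (permG_sig s)). Qed.

Lemma permG_funM : {morph permG_fun : s t / (s * t)%g}.
Proof.
move=> s t; apply: G21_inj => z i.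
by rewrite actM 3!permG_funE permM.
Qed.

HB.instance Definition _ := isMultiplicative.Build _ _ permG_fun permG_funM.
Definition permG : {multiplicative 'S_n.+1 -> G} := permG_fun.

Lemma permGE s z i : act (permG s) z i 0 = z (s i) 0.
Proof. exact: permG_funE. Qed.

Lemma flip_sig (i : 'I_n.+1) (v : R[i]) : in_lattice alpha v ->
  {f : G | forall z k, act f z k 0 = if k == i then v - z i 0 else z k 0}.
Proof.
move=> vP; apply: cid.
have [|f fE] := @G21_elt_exists (pred1 i) 1%g (\col_k (v *+ (k == i))).
  by move=> k; rewrite mxE; case: eqP => _ //; rewrite mulr0n; apply: in_lattice0.
exists f => z k; rewrite fE mxE perm1 /=; case: eqP => [->|_].
  by rewrite mulN1r addrC.
by rewrite mul1r mulr0n addr0.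
Qed.

Definition flip (i : 'I_n.+1) (v : R[i]) (vP : in_lattice alpha v) : G :=
  sval (flip_sig i vP).

Lemma flipE i v vP z k :
  act (@flip i v vP) z k 0 = if k == i then v - z i 0 else z k 0.
Proof. exact: (svalP (flip_sig i vP)). Qed.

Lemma flip_conj i v vP s : (@flip i v vP ^ permG s)%g = flip (s i) vP.
Proof.
rewrite conjgE -homV; apply: G21_inj => z k.
rewrite !actM permGE !flipE !permGE permKV.
by rewrite -(inj_eq (@perm_inj _ s)) permKV.
Qed.

Lemma flip_sq i v vP : (@flip i v vP * flip i vP)%g = 1%g.
Proof.
apply: G21_inj => z k; rewrite actM act1 !flipE eqxx.
by case: eqP => // ->; rewrite opprB addrC subrK.
Qed.

Lemma flip_commute i j v w vP wP : i != j -> commute (@flip i v vP) (@flip j w wP).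
Proof.
move=> ij; apply: G21_inj => z k; rewrite !actM !flipE [j == i]eq_sym (negPf ij).
by case: eqP => [->|//]; rewrite (negPf ij).
Qed.

Lemma flip3_sq i u v w uP vP wP :
  ((@flip i u uP * @flip i v vP * @flip i w wP) ^+ 2)%g = 1%g.
Proof.
apply: G21_inj => z k; rewrite expg2 !actM act1 !flipE eqxx.
by case: eqP => // ->; ring.
Qed.

(** The linear parts of the two reflections cancel. *)
Lemma flip_mul i v w vP wP :
  translates (@flip i v vP * @flip i w wP)%g ((v - w) *: delta_mx i 0).
Proof.
move=> z; apply/colP => k; rewrite actM !flipE eqxx !mxE eqxx andbT.
by case: eqP => [->|_]; rewrite ?mulr1 ?mulr0 ?addr0 //; ring.
Qed.

Let two_neq0 : (2 : R[i]) != 0. Proof. by rewrite pnatr_eq0. Qed.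

Lemma flip_reflection i v vP : is_reflection (val (@flip i v vP)).
Proof.
apply: (@is_reflectionP _ _ _ (fun z : V => 2 * z i 0) (delta_mx i 0) v) => //.
- by move=> a x y; rewrite !mxE; ring.
- by rewrite mxE !eqxx mulr1.
- move=> z; apply/colP => k; rewrite -actE flipE !mxE eqxx andbT.
  by case: eqP => [->|_]; rewrite ?mulr1 ?mulr0 ?subr0 //; ring.
Qed.

Lemma permG_tperm_reflection (i j : 'I_n.+1) : i != j ->
  is_reflection (val (permG (tperm i j))).
Proof.
move=> ij.
apply: (@is_reflectionP _ _ _ (fun z : V => z i 0 - z j 0) (delta_mx i 0 - delta_mx j 0) 0) => //.
- by move=> a x y; rewrite !mxE; ring.
- by rewrite !mxE !eqxx (negPf ij) eq_sym (negPf ij) /=; ring.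
- move=> z; apply/colP => k; rewrite -actE permGE !mxE eqxx !andbT subr0.
  case: tpermP => [->|->|/eqP/negPf -> /eqP/negPf ->].
  + by rewrite eqxx (negPf ij) /=; ring.
  + by rewrite eqxx eq_sym (negPf ij) /=; ring.
  + by rewrite subrr mulr0 subr0.
Qed.

Hypothesis alphaP : 0 < complex.Im alpha.

Lemma lattice1 : in_lattice alpha 1.
Proof. by exists 1, 0; rewrite mul0r addr0. Qed.

Lemma lattice_alpha : in_lattice alpha alpha.
Proof. by exists 0, 1; rewrite mul1r add0r. Qed.

Lemma lattice_independent (k : int * int) :
  k.1%:~R + k.2%:~R * alpha = 0 -> k = (0, 0).
Proof.
case: k => a b /= ab0.
have ImZ (c : int) (z : R[i]) : complex.Im (c%:~R * z) = c%:~R * complex.Im z.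
  by rewrite mulrzl mulrzl raddfMz.
have b0 : b = 0.
  have := congr1 (@complex.Im R) ab0; rewrite raddfD /= ImZ -[X in complex.Im X]mulr1 ImZ /=.
  by rewrite mulr0 add0r => /eqP; rewrite mulf_eq0 intr_eq0 (gt_eqF alphaP) orbF => /eqP.
by move: ab0; rewrite b0 mul0r addr0 => /eqP; rewrite intr_eq0 => /eqP ->.
Qed.

Let a0 := flip ord0 (in_lattice0 alpha).
Let bm := flip ord_max lattice1.
Let cm := flip ord_max lattice_alpha.

(** Conjugation by permutations relabels the flips ([flip_conj]), which reduces
    each relation to the commutation of flips of different coordinates or, for
    the long product, to [flip3_sq] at the coordinate 0. *)
Lemma relsG_flip (r : nat -> G) : (0 < n)%N ->
  (forall j, (j < n)%N -> r j = permG (adj n j)) -> relsG_eqs n r a0 bm cm.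
Proof.
move=> n_gt0 rE; have rE' j : (j < n)%N -> permG (adj n j) = r j by move/rE.
have cox : coxeterA n r := coxeterA_image rE.
have rV j : (j < n)%N -> ((r j)^-1)%g = r j.
  by move=> jn; apply: mulg1_eq; case: cox => sqr _ _; apply: sqr.
have cJ (g h : G) : (g ^ h)%g = g -> commute g h.
  by move=> gh; rewrite /commute conjgC gh.
have c4 (g : G) j : (j < n)%N -> commute g (g ^ r j)%g ->
    (g * r j * g * r j = r j * g * r j * g)%g.
  by move=> jn; rewrite conjgE rV // /commute !mulgA.
have adj0 : adj n 0 ord0 = inord 1.
  by apply: val_inj; rewrite /= adjE // inordK.
have adjm : adj n n.-1 ord_max = inord n.-1.
  by apply: val_inj; rewrite /= adjE; rewrite ?inordK /=; do ?case: ifP; lia.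
have fixm j : (j.+1 < n)%N -> adj n j ord_max = ord_max.
  by move=> jn; apply: val_inj; rewrite /= adjE /=; do ?case: ifP; lia.
have fix0 j : (0 < j < n)%N -> adj n j ord0 = ord0.
  by move=> jn; apply: val_inj; rewrite /= adjE /=; do ?case: ifP; lia.
have maxpre : ord_max != inord n.-1 :> 'I_n.+1.
  by rewrite -val_eqE /= inordK; lia.
have n1 : (n.-1 < n)%N by lia.
split; rewrite ?flip_sq //.
- rewrite (rho_upto rE') // -(rho_downto rE').
  set d := (\prod_(j <- downto n 0) adj n j)%g.
  have d0 : d ord_max = ord0.
    by apply: val_inj; rewrite /= prod_adj_downto ?leqnn // eqxx.
  have -> : (a0 * (permG d)^-1 * (bm * cm) * permG d = a0 * (bm * cm) ^ permG d)%g.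
    by rewrite conjgE !mulgA.
  by rewrite conjMg !flip_conj d0 mulgA flip3_sq.
- by move=> j jn; apply: cJ; rewrite rE ?flip_conj ?fix0 //; lia.
- by move=> j jn; apply: cJ; rewrite rE ?flip_conj ?fixm //; lia.
- by move=> j jn; apply: cJ; rewrite rE ?flip_conj ?fixm //; lia.
- by apply: flip_commute; rewrite -val_eqE /=; lia.
- by apply: flip_commute; rewrite -val_eqE /=; lia.
- by apply: c4 => //; rewrite rE // flip_conj adj0; apply: flip_commute; rewrite -val_eqE /= inordK.
- by apply: c4 => //; rewrite rE // flip_conj adjm; apply: flip_commute.
- by apply: c4 => //; rewrite rE // flip_conj adjm; apply: flip_commute.
- have -> : (r n.-1 * bm * (r n.-1)^-1 = bm ^ r n.-1)%g by rewrite conjgE rV // mulgA.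
  rewrite rE // flip_conj adjm flip_commute 1?eq_sym //.
  by rewrite -adjm -flip_conj -rE // conjgE rV // !mulgA.
Qed.

End SignedPermutations.

Section SignedPermutationGroup.
Variables (R : realType) (alpha : R[i]) (n : nat).
Hypothesis alphaP : 0 < complex.Im alpha.
Local Notation V := 'cV[R[i]]_n.+1.
Local Notation G := (G21 n.+1 alpha).
Local Notation permG := (@permG R alpha n).

Definition flip0 (i : 'I_n.+1) : G := flip i (in_lattice0 alpha).
Definition flip1 (i : 'I_n.+1) : G := flip i (lattice1 alpha).
Definition flip_alpha (i : 'I_n.+1) : G := flip i (lattice_alpha alpha).

(** The image of a piece of the normal form: an arbitrary element of the factor
    {z |-> +-z + t} at the coordinate i. *)
Definition coordinate_motion (i : 'I_n.+1) (k : int * int) (e : bool) : G :=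
  (lattice_word (flip0 i * flip1 i) (flip0 i * flip_alpha i) k * flip0 i ^+ e)%g.

Lemma coordinate_motionE i k e z j :
  act (coordinate_motion i k e) z j 0 =
  if j == i then (-1) ^+ e * z i 0 - (k.1%:~R + k.2%:~R * alpha) else z j 0.
Proof.
rewrite actM (translates_lattice_word _ (flip_mul _ _ _) (flip_mul _ _ _)).
have fE : act (flip0 i ^+ e)%g z j 0 = if j == i then (-1) ^+ e * z i 0 else z j 0.
  case: e; first by rewrite expg1 flipE sub0r mulN1r.
  by rewrite act1 mul1r; case: eqP => [->|].
rewrite mxE fE -(scaler_int k.1 (_ : V)) -(scaler_int k.2 (_ : V)) !mxE eqxx andbT.
by case: eqP => _; rewrite ?mulr0 ?mul0r ?addr0 ?mulr1; ring.
Qed.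

Lemma coordinate_motions_perm (k : 'I_n.+1 -> int * int) (e : 'I_n.+1 -> bool)
    (s : 'S_n.+1) z j :
  act ((\prod_i coordinate_motion i (k i) (e i)) * permG s)%g z j 0
  = (-1) ^+ e j * z (s j) 0 - ((k j).1%:~R + (k j).2%:~R * alpha).
Proof.
rewrite actM.
have prodE (l : seq 'I_n.+1) w : uniq l ->
    act (\prod_(i <- l) coordinate_motion i (k i) (e i))%g w j 0 =
    if j \in l then (-1) ^+ e j * w j 0 - ((k j).1%:~R + (k j).2%:~R * alpha) else w j 0.
  elim: l => [|i l IH]; first by rewrite big_nil act1.
  rewrite cons_uniq.
  case/andP=> il ul; rewrite big_cons actM coordinate_motionE inE.
  case: eqP => [ji|_]; last by rewrite IH.
  by move: il; rewrite -ji IH // => /negPf ->.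
by rewrite prodE ?index_enum_uniq // mem_index_enum permGE.
Qed.

(** Evaluation at 0 shows that the translation parts vanish; evaluation at the
    j-th basis vector then shows that s fixes j and that the sign is 1. *)
Lemma coordinate_motions_perm_eq1 (k : 'I_n.+1 -> int * int) (e : 'I_n.+1 -> bool)
    (s : 'S_n.+1) :
    ((\prod_i coordinate_motion i (k i) (e i)) * permG s)%g = 1%g ->
  [/\ forall i, k i = (0, 0), forall i, e i = false & s = 1%g].
Proof.
move=> w1.
have zE (z : V) j : (-1) ^+ e j * z (s j) 0 - ((k j).1%:~R + (k j).2%:~R * alpha) = z j 0.
  by rewrite -coordinate_motions_perm w1 act1.
have k0 i : k i = (0, 0).
  apply: (lattice_independent alphaP); have := zE 0 i.
  by rewrite !mxE mulr0 sub0r => /eqP; rewrite oppr_eq0 => /eqP.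
have {}zE (z : V) j : (-1) ^+ e j * z (s j) 0 = z j 0.
  by have := zE z j; rewrite k0 /= mul0r addr0 subr0.
have se j : s j = j /\ e j = false.
  have := zE (delta_mx j 0) j; rewrite !mxE !eqxx andbT /=.
  case: (s j =P j) => [sj|_] /=; last by move=> /eqP; rewrite mulr0 eq_sym oner_eq0.
  have N1 : (-1) ^+ true != 1 :> R[i].
    by rewrite expr1 -subr_eq0 -opprD oppr_eq0 -[1 + 1]/(2%:R) pnatr_eq0.
  by rewrite mulr1; case: (e j) => // /eqP; rewrite (negPf N1).
split=> // [i|]; first by case: (se i).
by apply/permP => i; rewrite perm1; case: (se i).
Qed.

(** Flips at all coordinates are conjugate under permutations, products of them
    give all sign changes and translations, and an element of the group is a
    product of such with a permutation. *)
Lemma G21_generated (Im : G -> Prop) :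
    Im 1%g -> (forall f g, Im f -> Im g -> Im (f * g)%g) -> (forall f, Im f -> Im (f^-1)%g) ->
    (forall s, Im (permG s)) ->
    Im (flip0 ord0) -> Im (flip1 ord_max) -> Im (flip_alpha ord_max) ->
  forall f, Im f.
Proof.
move=> Im1 ImM ImV Imp Im0 Imb Imc f.
have ImJ f' g : Im f' -> Im g -> Im (f' ^ g)%g.
  by move=> ff gg; rewrite conjgE; apply: (ImM); [apply: ImV|apply: ImM].
have Imf0 i : Im (flip0 i) by rewrite /flip0 -(tpermL ord0 i) -flip_conj; apply: ImJ.
have Imf1 i : Im (flip1 i) by rewrite /flip1 -(tpermL ord_max i) -flip_conj; apply: ImJ.
have Imfa i : Im (flip_alpha i) by rewrite /flip_alpha -(tpermL ord_max i) -flip_conj; apply: ImJ.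
have ImW i k e : Im (coordinate_motion i k e).
  have ImX g m : Im g -> Im (expgz g m).
    have ImXn j : Im g -> Im (g ^+ j)%g.
      by move=> gI; elim: j => // j IH; rewrite expgS; apply: ImM.
    by case: m => m gI /=; [|apply: ImV]; apply: ImXn.
  by apply: (ImM); [apply: (ImM); apply: ImX; apply: ImM|case: e; [exact: Imf0|exact: Im1]].
have ImP (l : seq 'I_n.+1) (w : 'I_n.+1 -> G) : (forall i, Im (w i)) -> Im (\prod_(i <- l) w i)%g.
  by move=> wI; elim: l => [|i l IH]; rewrite ?big_nil // big_cons; apply: ImM.
have /asboolP[eps [s [t [tP fE]]]] := valP f.
have tk i : exists k : int * int, t i 0 = - (k.1%:~R + k.2%:~R * alpha).
  have [a [b ->]] := tP i; exists (- a, - b) => /=.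
  by rewrite !mulrNz mulNr -opprD opprK.
have /choice[k kE] := tk.
suff -> : f = ((\prod_i coordinate_motion i (k i) (eps i)) * permG s)%g.
  by apply: (ImM) => //; apply: ImP.
apply: G21_inj => z i; rewrite coordinate_motions_perm -kE actE fE mxE.
by rewrite mul_signed_perm_mx.
Qed.

(** The normal form of the presented group is mapped by phi to a product of
    coordinate motions and a permutation, and such a product is trivial only if
    all its parameters are. *)
Lemma G21_reflection_presentation : (0 < n)%N ->
  reflection_presentation (G21 n.+1 alpha) (@relsG n.+1).
Proof.
move=> n_gt0.
pose g (i : 'I_n.+3) : G := if i == 0%N :> nat then flip0 ord0 else
  if (i <= n)%N then permG (adj n i.-1) else
  if i == n.+1 :> nat then flip1 ord_max else flip_alpha ord_max.
have g0 : g (inord 0) = flip0 ord0 by rewrite /g inordK.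
have gr j : (j < n)%N -> g (inord j.+1) = permG (adj n j).
  by move=> jn; rewrite /g inordK ?jn //; lia.
have gb : g (inord n.+1) = flip1 ord_max by rewrite /g inordK // ltnn eqxx.
have gc : g (inord n.+2) = flip_alpha ord_max.
  have -> : g (inord n.+2) = if (n.+2 <= n)%N then permG (adj n n.+1) else
      if n.+2 == n.+1 then flip1 ord_max else flip_alpha ord_max by rewrite /g inordK.
  by rewrite ifF ?ifF //; lia.
apply: (presentation_criterion (g := g)).
- apply/satisfies_relsG => //; rewrite g0 gb gc.
  exact: relsG_flip.
- move=> i; rewrite /g; case: eqVneq => i0; first exact: flip_reflection.
  case: ifP => iN; first by apply/permG_tperm_reflection/adj_neq; lia.
  by case: eqP => _; apply: flip_reflection.
move=> phi phig.
pose P := presented (@relsG n.+1).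
have /satisfies_relsG := @pgen_satisfies _ (@relsG n.+1) => /(_ n_gt0) E.
have [rho rhoE] := coxeterA_hom (relsG_cox E).
have phir j : (j < n)%N -> phi (rho (adj n j)) = permG (adj n j).
  by move=> jn; rewrite rhoE // phig gr.
have phirho := hom_perm_ext phir.
have phi_orbit base x v (vP : in_lattice alpha v) i : phi x = flip base vP ->
    phi (orbit_of rho base x i) = flip i vP.
  by move=> phix; rewrite /orbit_of homJ phirho phix flip_conj tpermL.
split=> [x phix|].
  have [] := @wreath_normal_form _ _ _ _ _ _ n_gt0 E rho rhoE x.
    apply: presented_mgen_invol => i.
      have := @pgen_satisfies _ (@relsG n.+1) _ _ (@relsG_sq n.+1 i.+1 (ltn_ord i)).
      by rewrite wevalX2 weval_gen weval1 inord_val expg2.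
    have iE k : i = k :> nat -> i = inord k by move=> <-; rewrite inord_val.
    have [/iE ->|i0] := eqVneq (i : nat) 0%N; first by constructor 2.
    have [/iE ->|i1] := eqVneq (i : nat) n.+1; first by constructor 3.
    have [/iE ->|i2] := eqVneq (i : nat) n.+2; first by constructor 4.
    constructor 1; exists i.-1; first by have := ltn_ord i; lia.
    by congr pgen; apply: iE; lia.
  move=> k [e [s xE]].
  have : phi x = ((\prod_i coordinate_motion i (k i) (e i)) * permG s)%g.
    rewrite xE gmulfM phirho hom_prod; congr (_ * _)%g; apply: eq_bigr => i _.
    rewrite gmulfM hom_lattice_word !(gmulfM (orbit_of _ _ _ _)).
    have fX (y : P) (b : bool) : phi (y ^+ b)%g = (phi y ^+ b)%g.
      by case: b; rewrite ?expg0 ?hom1 ?expg1.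
    have phiu : phi (orbit_of rho ord0 (pgen _ (inord 0)) i) = flip0 i.
      by apply: phi_orbit; rewrite phig g0.
    have phiv : phi (orbit_of rho ord_max (pgen _ (inord n.+1)) i) = flip1 i.
      by apply: phi_orbit; rewrite phig gb.
    have phiw : phi (orbit_of rho ord_max (pgen _ (inord n.+2)) i) = flip_alpha i.
      by apply: phi_orbit; rewrite phig gc.
    by rewrite fX phiu phiv phiw.
  rewrite phix => /esym/coordinate_motions_perm_eq1[k0 e0 s1].
  by rewrite xE s1 hom1 mulg1 big1 // => i _; rewrite k0 e0 lattice_word0 mulg1.
apply: G21_generated.
- by exists 1%g; rewrite hom1.
- by move=> _ _ [x <-] [y <-]; exists (x * y)%g; rewrite gmulfM.
- by move=> _ [x <-]; exists x^-1%g; rewrite homV.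
- by move=> s; exists (rho s).
- by exists (pgen _ (inord 0)); rewrite phig g0.
- by exists (pgen _ (inord n.+1)); rewrite phig gb.
- by exists (pgen _ (inord n.+2)); rewrite phig gc.
Qed.

End SignedPermutationGroup.

Lemma G21_1_reflection_presentation (R : realType) (alpha : R[i]) :
  0 < complex.Im alpha -> reflection_presentation (G21 1 alpha) rels1.
Proof.
move=> alphaP.
pose g (i : 'I_3) : G21 1 alpha := if i == 0%N :> nat then flip0 alpha ord0 else
  if i == 1%N :> nat then flip1 alpha ord0 else flip_alpha alpha ord0.
have g0 : g (inord 0) = flip0 alpha ord0 by rewrite /g inordK.
have g1 : g (inord 1) = flip1 alpha ord0 by rewrite /g inordK.
have g2 : g (inord 2) = flip_alpha alpha ord0 by rewrite /g inordK.
apply: (presentation_criterion (g := g)).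
- apply/satisfies_rels1; rewrite g0 g1 g2; split; last exact: flip3_sq.
  by move=> i; rewrite /g; do !case: ifP => _; apply: flip_sq.
- by move=> i; rewrite /g; do !case: ifP => _; apply: flip_reflection.
move=> phi phig.
have S1 (s : 'S_1) : s = 1%g by apply/permP => i; rewrite !ord1.
split=> [x phix|].
  have [k [e xE]] := presented_rels1_normal_form x.
  have : phi x = ((\prod_i coordinate_motion alpha i k e) * @permG R alpha 0 1)%g.
    rewrite hom1 mulg1 big_ord1 xE gmulfM hom_lattice_word !gmulfM !phig g0 g1 g2.
    by congr (_ * _)%g; case: e {xE}; rewrite ?expg1 ?phig ?g0 // hom1.
  rewrite phix => /esym/(coordinate_motions_perm_eq1 alphaP)[k0 e0 _].
  by rewrite xE (k0 ord0) (e0 ord0) lattice_word0 mulg1.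
have m0 : ord_max = ord0 :> 'I_1 by rewrite ord1.
apply: G21_generated; rewrite ?m0.
- by exists 1%g; rewrite hom1.
- by move=> _ _ [x <-] [y <-]; exists (x * y)%g; rewrite gmulfM.
- by move=> _ [x <-]; exists x^-1%g; rewrite homV.
- by move=> s; exists 1%g; rewrite (S1 s) !hom1.
- by exists (pgen _ (inord 0)); rewrite phig g0.
- by exists (pgen _ (inord 1)); rewrite phig g1.
- by exists (pgen _ (inord 2)); rewrite phig g2.
Qed.

(** * The groups of type A *)

Section AffineSymmetricGroup.
Variables (R : realType) (alpha : R[i]) (n : nat).
Hypothesis n_gt0 : (0 < n)%N.
Local Notation V := 'cV[R[i]]_n.+1.
Local Notation W := (subvs_of (sum0 R n.+1)).
Local Notation G := (WA n.+1 alpha).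
Implicit Types (s : 'S_n.+1) (i j : 'I_n.+1).

Lemma WA_inj (f g : G) :
  (forall z i, vsval (act f z) i 0 = vsval (act g z) i 0) -> f = g.
Proof.
move=> fg; apply: act_inj => z; apply: val_inj; apply/colP => i; exact: fg.
Qed.

Lemma sum0_val (z : W) : \sum_i vsval z i 0 = 0.
Proof. by apply/eqP; rewrite -mem_sum0; apply: subvsP. Qed.

Lemma root_in (i j : 'I_n.+1) : delta_mx i 0 - delta_mx j 0 \in sum0 R n.+1.
Proof.
rewrite mem_sum0; apply/eqP.
under eq_bigr do rewrite !mxE !eqxx !andbT.
rewrite sumrB (bigD1 i) //= big1 => [|k /negPf ->] //.
by rewrite (bigD1 j) //= big1 => [|k /negPf -> //]; rewrite !eqxx; ring.
Qed.

Definition root (i j : 'I_n.+1) : W := vsproj (sum0 R n.+1) (delta_mx i 0 - delta_mx j 0).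

Lemma rootE i j k : vsval (root i j) k 0 = (k == i)%:R - (k == j)%:R.
Proof. by rewrite vsprojK ?root_in // !mxE !eqxx !andbT. Qed.

Lemma root_diag i : root i i = 0.
Proof. by apply: val_inj; apply/colP => k; rewrite [LHS]rootE subrr raddf0 mxE. Qed.

Lemma opp_root i j : - root i j = root j i.
Proof.
apply: val_inj; apply/colP => k; rewrite [RHS]rootE raddfN mxE.
by rewrite [X in - X]rootE opprB.
Qed.

Lemma scale_rootE (a : R[i]) i j k :
  vsval (a *: root i j) k 0 = a * ((k == i)%:R - (k == j)%:R).
Proof. by rewrite linearZ /= mxE rootE. Qed.

Lemma WA_elt_exists s (t : W) : (forall i, in_lattice alpha (vsval t i 0)) ->
  exists f : G, forall z i, vsval (act f z) i 0 = vsval z (s i) 0 + vsval t i 0.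
Proof.
move=> tP; pose U := sum0 R n.+1.
have permP (z : W) : row_perm s (vsval z) \in U.
  rewrite mem_sum0; apply/eqP; rewrite -[RHS](sum0_val z).
  rewrite [RHS](reindex_inj (@perm_inj _ s)).
  by apply: eq_bigr => i _; rewrite mxE.
pose L := linfun (vsproj U \o row_perm s \o vsval : W -> W).
have LE (z : W) i : vsval (L z) i 0 = vsval z (s i) 0.
  by rewrite lfunE /= vsprojK // mxE.
have Linj : lker L == 0%VS.
  apply/lker0P => u v uv; apply: val_inj; apply/colP => i.
  by have := congr1 (fun w : W => vsval w (s^-1%g i) 0) uv; rewrite /= !LE permKV.
pose f : affine W := exist _ (L, t) Linj.
have fE z i : vsval (aff_fun f z) i 0 = vsval z (s i) 0 + vsval t i 0.
  by rewrite /aff_fun linearD /= mxE LE.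
have fP : WA_pred alpha f.
  apply/asboolP; exists s, t; split=> // z.
  by apply/colP => i; rewrite [LHS]fE !mxE.
by exists (exist _ f fP) => z i; rewrite actE.
Qed.

Lemma permA_sig s :
  {f : G | forall z i, vsval (act f z) i 0 = vsval z (s i) 0}.
Proof.
apply: cid; have [|f fE] := @WA_elt_exists s 0.
  by move=> i; rewrite linear0 mxE; apply: in_lattice0.
by exists f => z i; rewrite fE linear0 mxE addr0.
Qed.

Definition permA_fun s : G := sval (permA_sig s).

Lemma permA_funE s z i : vsval (act (permA_fun s) z) i 0 = vsval z (s i) 0.
Proof. exact: (svalP (permA_sig s)). Qed.

Lemma permA_funM : {morph permA_fun : s t / (s * t)%g}.
Proof.
move=> s t; apply: WA_inj => z i.
by rewrite actM 3!permA_funE permM.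
Qed.

HB.instance Definition _ := isMultiplicative.Build _ _ permA_fun permA_funM.
Definition permA : {multiplicative 'S_n.+1 -> G} := permA_fun.

Lemma permAE s z i : vsval (act (permA s) z) i 0 = vsval z (s i) 0.
Proof. exact: permA_funE. Qed.

Lemma aff_refl_sig i j (v : R[i]) : in_lattice alpha v ->
  {f : G | forall z k, vsval (act f z) k 0
    = vsval z (tperm i j k) 0 + v * ((k == i)%:R - (k == j)%:R)}.
Proof.
move=> vP; apply: cid; have [k|f fE] := @WA_elt_exists (tperm i j) (v *: root i j).
  rewrite scale_rootE; case: (k == i) => /=; case: (k == j) => /=;
    rewrite ?subrr ?subr0 ?sub0r ?mulr0 ?mulr1 ?mulrN1 //.
  - exact: in_lattice0.
  - exact: in_latticeN.
  - exact: in_lattice0.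
by exists f => z k; rewrite fE scale_rootE.
Qed.

(** The affine reflection along e_i - e_j; the hyperplane it fixes is
    z_i - z_j = v. *)
Definition aff_refl i j (v : R[i]) (vP : in_lattice alpha v) : G := sval (aff_refl_sig i j vP).

Lemma aff_reflE i j v vP z k :
  vsval (act (@aff_refl i j v vP) z) k 0
  = vsval z (tperm i j k) 0 + v * ((k == i)%:R - (k == j)%:R).
Proof. exact: (svalP (aff_refl_sig i j vP)). Qed.

Lemma aff_refl_conj i j v vP s : (@aff_refl i j v vP ^ permA s)%g = aff_refl (s i) (s j) vP.
Proof.
rewrite conjgE -homV; apply: WA_inj => z k.
rewrite 2!actM permAE 2!aff_reflE permAE.
have eqs l : ((s^-1)%g k == l) = (k == s l) by rewrite -(inj_eq (@perm_inj _ s)) permKV.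
rewrite !eqs -tpermJ; congr (vsval z _ 0 + _).
by rewrite !conjgE !permM.
Qed.

Lemma aff_refl_sq i j v vP : i != j -> (@aff_refl i j v vP * aff_refl i j vP)%g = 1%g.
Proof.
move=> ij; apply: WA_inj => z k; rewrite actM act1 2!aff_reflE tpermK.
have tE : (tperm i j k == i) = (k == j) by rewrite -{2}(tpermR i j) (inj_eq perm_inj).
have tE' : (tperm i j k == j) = (k == i) by rewrite -{2}(tpermL i j) (inj_eq perm_inj).
by rewrite tE tE'; ring.
Qed.

(** Two reflections along the same root differ by a translation. *)
Lemma aff_refl_mul i j v w vP wP : i != j ->
  translates (@aff_refl i j v vP * @aff_refl i j w wP)%g ((v - w) *: root i j).
Proof.
move=> ij z; apply: val_inj; apply/colP => k; rewrite actM 2!aff_reflE tpermK.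
have tE : (tperm i j k == i) = (k == j) by rewrite -{2}(tpermR i j) (inj_eq perm_inj).
have tE' : (tperm i j k == j) = (k == i) by rewrite -{2}(tpermL i j) (inj_eq perm_inj).
by rewrite tE tE' raddfD [RHS]mxE scale_rootE; ring.
Qed.

Lemma aff_refl0 i j : aff_refl i j (in_lattice0 alpha) = permA (tperm i j).
Proof. by apply: WA_inj => z k; rewrite aff_reflE permAE mul0r addr0. Qed.

Lemma aff_refl3_sq i j u v w uP vP wP : i != j ->
  ((@aff_refl i j u uP * @aff_refl i j v vP * @aff_refl i j w wP) ^+ 2)%g = 1%g.
Proof.
move=> ij; apply: WA_inj => z k; rewrite expg2 5!actM act1 6!aff_reflE !tpermK.
have tE l : (tperm i j l == i) = (l == j) by rewrite -{2}(tpermR i j) (inj_eq perm_inj).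
have tE' l : (tperm i j l == j) = (l == i) by rewrite -{2}(tpermL i j) (inj_eq perm_inj).
by rewrite !(tE, tE'); ring.
Qed.

Lemma aff_refl_reflection i j v vP : i != j -> is_reflection (val (@aff_refl i j v vP)).
Proof.
move=> ij.
apply: (@is_reflectionP _ _ _ (fun z : W => vsval z i 0 - vsval z j 0) (root i j) v) => //.
- by rewrite pnatr_eq0.
- by move=> a x y; rewrite !linearP /= !mxE; ring.
- by rewrite !rootE !eqxx (negPf ij) eq_sym (negPf ij) /=; ring.
- move=> z; apply: val_inj; apply/colP => k.
  have vB (x y : W) : vsval (x - y) k 0 = vsval x k 0 - vsval y k 0.
    by rewrite raddfB mxE [X in _ + X = _]mxE.
  rewrite -actE aff_reflE vB scale_rootE.
  case: tpermP => [->|->|/eqP/negPf -> /eqP/negPf ->].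
  + by rewrite eqxx (negPf ij) /=; ring.
  + by rewrite eqxx eq_sym (negPf ij) /=; ring.
  + by rewrite subrr !mulr0 addr0 subr0.
Qed.

Lemma sum_rootE (a : 'I_n.+1 -> R[i]) k :
  vsval (\sum_i a i *: root ord0 i) k 0 = (k == ord0)%:R * (\sum_i a i) - a k.
Proof.
rewrite raddf_sum summxE.
under eq_bigr do rewrite scale_rootE mulrBr.
rewrite sumrB -mulr_suml mulrC; congr (_ - _).
by rewrite (bigD1 k) //= eqxx mulr1 big1 ?addr0 // => i /negPf ik; rewrite eq_sym ik mulr0.
Qed.

Lemma lattice_word_root i j (f g : G) (k : int * int) :
    translates f (1 *: root i j) -> translates g (alpha *: root i j) ->
  translates (lattice_word f g k) ((k.1%:~R + k.2%:~R * alpha) *: root i j).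
Proof.
move=> ft gt; have := translates_lattice_word k ft gt.
by rewrite scale1r -(scaler_int k.1 (root _ _)) -(scaler_int k.2) scalerA scalerDl.
Qed.

(** The image of 0 gives t = 0; the coordinate k of the root e_k - e_l is the only
    one equal to 1, so s fixes k. *)
Lemma translation_perm_eq1 (f : G) t s : translates f t -> (f * permA s)%g = 1%g ->
  t = 0 /\ s = 1%g.
Proof.
move=> ft f1; have zE (z : W) k : vsval z (s k) 0 + vsval t k 0 = vsval z k 0.
  by have := congr1 (fun h : G => vsval (act h z) k 0) f1; rewrite actM ft act1 raddfD mxE permAE.
have t0 k : vsval t k 0 = 0 by have := zE 0 k; rewrite raddf0 !mxE add0r.
split.
  by apply: val_inj; apply/colP => k; rewrite [LHS]t0 raddf0 mxE.
apply/permP => k; rewrite perm1.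
pose l : 'I_n.+1 := if k == ord0 then ord_max else ord0.
have kl : k != l.
  rewrite /l; have [->|//] := eqVneq k ord0; rewrite -val_eqE /=; lia.
have := zE (root k l) k; rewrite t0 addr0 !rootE eqxx (negPf kl) subr0.
have [//|_] := eqVneq (s k) k; case: (s k == l) => /eqP.
  rewrite sub0r -subr_eq0 -opprD oppr_eq0 -[1%:R + 1%:R]natrD pnatr_eq0 //.
by rewrite subr0 eq_sym pnatr_eq0.
Qed.

(** The roots e_0 - e_i form a basis: t is the sum of - t_i (e_0 - e_i), where the
    coefficient of e_0 is right because the coordinates of t add up to 0. *)
Lemma WA_generated (Im : G -> Prop) :
    Im 1%g -> (forall f g, Im f -> Im g -> Im (f * g)%g) -> (forall f, Im f -> Im (f^-1)%g) ->
    (forall s, Im (permA s)) ->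
    Im (aff_refl ord0 ord_max (lattice1 alpha)) ->
    Im (aff_refl ord0 ord_max (lattice_alpha alpha)) ->
  forall f, Im f.
Proof.
move=> Im1 ImM ImV Imp Imb Imc f.
have ImJ f' g : Im f' -> Im g -> Im (f' ^ g)%g.
  by move=> ff gg; rewrite conjgE; apply: (ImM); [apply: ImV|apply: ImM].
have ImX g m : Im g -> Im (expgz g m).
  have ImXn (d : nat) : Im g -> Im (g ^+ d)%g.
    by move=> gI; elim: d => [|d IH]; [exact: Im1|rewrite expgS; exact: ImM].
  by case: m => m gI /=; [|apply: ImV]; apply: ImXn.
have Imroot i v (vP : in_lattice alpha v) : Im (aff_refl ord0 ord_max vP) ->
    exists2 g, Im g & translates g (v *: root ord0 i).
  move=> Iv; have [->|i0] := eqVneq i ord0.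
    by exists 1%g => //; rewrite root_diag scaler0; apply: translates1.
  exists (aff_refl ord0 i vP * aff_refl ord0 i (in_lattice0 alpha))%g.
    apply: (ImM); last by rewrite aff_refl0.
    suff <- : (aff_refl ord0 ord_max vP ^ permA (tperm ord_max i))%g = aff_refl ord0 i vP.
      exact: ImJ.
    by rewrite aff_refl_conj tpermL tpermD // -val_eqE /=; lia.
  by rewrite -[X in X *: _]subr0; apply: aff_refl_mul; rewrite eq_sym.
have Imsum (l : seq 'I_n.+1) (k : 'I_n.+1 -> int * int) : exists2 g, Im g &
    translates g (\sum_(i <- l) ((k i).1%:~R + (k i).2%:~R * alpha) *: root ord0 i).
  elim: l => [|i l [g gI gt]].
    by exists 1%g => //; rewrite big_nil; apply: translates1.
  have [g1 g1I g1t] := Imroot i _ _ Imb; have [g2 g2I g2t] := Imroot i _ _ Imc.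
  exists (lattice_word g1 g2 (k i) * g)%g.
    by apply: (ImM) => //; apply: (ImM); apply: ImX.
  by rewrite big_cons; apply: translatesM => //; apply: lattice_word_root.
have /asboolP[s [t [tP fE]]] := valP f.
have tk i : exists k : int * int, - vsval t i 0 = k.1%:~R + k.2%:~R * alpha.
  by have [a [b ->]] := in_latticeN (tP i); exists (a, b).
have /choice[k kE] := tk.
have [g gI gt] := Imsum (index_enum 'I_n.+1) k.
suff -> : f = (g * permA s)%g by apply: ImM.
apply: WA_inj => z j; rewrite actM gt raddfD [RHS]mxE permAE sum_rootE.
have -> : \sum_i ((k i).1%:~R + (k i).2%:~R * alpha) = 0.
  by under eq_bigr do rewrite -kE; rewrite sumrN sum0_val oppr0.
by rewrite -kE mulr0 sub0r opprK actE fE !mxE.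
Qed.

Definition root_sign (i j k : 'I_n.+1) : R[i] := (k == i)%:R - (k == j)%:R.

Lemma root_sign_tperm i j k x : i != j -> i != k -> j != k ->
  root_sign i j x + root_sign i j (tperm i k (tperm i j x)) = root_sign i j (tperm i k x).
Proof.
move=> ij ik jk; rewrite /root_sign.
have ji : j != i by rewrite eq_sym. have ki : k != i by rewrite eq_sym.
have kj : k != j by rewrite eq_sym.
have [->|xi] := eqVneq x i.
  by rewrite !tpermL (tpermD ij kj) !eqxx (negPf ij) (negPf ji) (negPf ki) (negPf kj) /=; ring.
have [->|xj] := eqVneq x j.
  by rewrite tpermR tpermL (tpermD ij kj) !eqxx (negPf ji) (negPf ki) (negPf kj) /=; ring.
have [->|xk] := eqVneq x k.
  rewrite (tpermD ik jk) tpermR !eqxx (negPf ij); ring.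
rewrite (tpermD (z := x)) 1?eq_sym // (tpermD (z := x)) 1?eq_sym //.
by rewrite (negPf xi) (negPf xj); ring.
Qed.

Lemma root_signC i j k : root_sign j i k = - root_sign i j k.
Proof. by rewrite opprB. Qed.

(** The permutations of both sides agree by the braid relation of transpositions;
    the translation parts agree by [root_sign_tperm]. *)
Lemma aff_refl_braid i j k v vP (s : 'S_n.+1) : i != j -> i != k -> j != k ->
    s = tperm i k \/ s = tperm j k ->
  (@aff_refl i j v vP * permA s * aff_refl i j vP = permA s * aff_refl i j vP * permA s)%g.
Proof.
move=> ij ik jk sE; apply: WA_inj => z x.
have sgn : root_sign i j x + root_sign i j (s (tperm i j x)) = root_sign i j (s x).
  case: sE => ->; first exact: root_sign_tperm.
  apply: oppr_inj; rewrite opprD -!(root_signC i j) [tperm i j]tpermC.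
  by apply: root_sign_tperm; rewrite // eq_sym.
have prm : (tperm i j * s * tperm i j = s * tperm i j * s)%g.
  have sV : (s^-1 = s)%g by case: sE => ->; rewrite tpermV.
  transitivity (s ^ tperm i j)%g; first by rewrite conjgE tpermV mulgA.
  transitivity (tperm i j ^ s)%g; last by rewrite conjgE sV mulgA.
  have ji : j != i by rewrite eq_sym.
  have kj : k != j by rewrite eq_sym.
  have ki : k != i by rewrite eq_sym.
  case: sE => ->; rewrite !tpermJ !tpermL ?tpermR.
    by rewrite (tpermD ik jk) (tpermD ij kj) tpermC.
  by rewrite (tpermD ik jk) (tpermD ji ki).
rewrite 4!actM !(permAE, aff_reflE) -!/(root_sign i j _) -sgn.
have := congr1 (fun w : 'S_n.+1 => w x) prm; rewrite !permM => ->.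
by rewrite [in RHS]mulrDr [RHS]addrA [RHS]addrAC.
Qed.

Section Relations.
Hypothesis n_gt1 : (1 < n)%N.

Let max0 : ord_max != ord0 :> 'I_n.+1. Proof. by rewrite -val_eqE /=; lia. Qed.
Let o0max : ord0 != ord_max :> 'I_n.+1. Proof. by rewrite eq_sym. Qed.
Let p := aff_refl ord0 ord_max (lattice1 alpha).
Let q := aff_refl ord0 ord_max (lattice_alpha alpha).

(** As for [relsG_flip], conjugation by permutations reduces the relations to
    special cases: the long product becomes one of three reflections along
    e_0 - e_1. The last relation is compared coordinate by coordinate. *)
Lemma relsA_aff_refl (r : nat -> G) :
  (forall j : nat, (j < n)%N -> r j = permA (adj n j)) -> relsA_eqs n r p q.
Proof.
move=> rE; have rE' (j : nat) : (j < n)%N -> permA (adj n j) = r j by move/rE.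
have cox : coxeterA n r := coxeterA_image rE.
have rV (j : nat) : (j < n)%N -> ((r j)^-1)%g = r j.
  by move=> jn; apply: mulg1_eq; case: cox => sqr _ _; apply: sqr.
have cJ (g h : G) : (g ^ h)%g = g -> commute g h.
  by move=> gh; rewrite /commute conjgC gh.
have fixm (j : nat) : (0 < j < n.-1)%N -> adj n j ord_max = ord_max.
  by move=> jn; apply: val_inj; rewrite /= adjE /=; do ?case: ifP; lia.
have fix0 (j : nat) : (0 < j < n.-1)%N -> adj n j ord0 = ord0.
  by move=> jn; apply: val_inj; rewrite /= adjE /=; do ?case: ifP; lia.
pose one : 'I_n.+1 := inord 1; pose pre : 'I_n.+1 := inord n.-1.
have oneE : one = 1%N :> nat by rewrite inordK; lia.
have preE : pre = n.-1 :> nat by rewrite inordK; lia.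
have inord0 : inord 0 = ord0 :> 'I_n.+1 by apply: val_inj; rewrite /= inordK.
have inordm : inord n = ord_max :> 'I_n.+1 by apply: val_inj; rewrite /= inordK.
have o01 : ord0 != one by rewrite -val_eqE /= oneE.
have omax1 : ord_max != one by rewrite -val_eqE /= oneE; lia.
have o0pre : ord0 != pre by rewrite -val_eqE /= preE; lia.
have omaxpre : ord_max != pre by rewrite -val_eqE /= preE; lia.
have r0E : r 0%N = permA (tperm ord0 one) by rewrite rE ?/adj ?inord0 //; lia.
have rnE : r n.-1 = permA (tperm ord_max pre).
  by rewrite rE ?/adj ?prednK ?inordm 1?tpermC //; lia.
split; rewrite ?aff_refl_sq //.
- rewrite big_ltn; last lia.
  rewrite (rho_upto rE') // -(rho_downto rE').
  set d := (\prod_(j <- downto n 1) adj n j)%g.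
  have dm : d ord_max = one.
    by apply: val_inj; rewrite /= prod_adj_downto ?eqxx ?oneE //; lia.
  have d0 : d ord0 = ord0.
    by apply: val_inj; rewrite /= prod_adj_downto /=; [case: ifP|]; lia.
  have -> : (r 0 * (permA d)^-1 * (p * q) * permA d = r 0 * (p * q) ^ permA d)%g.
    by rewrite conjgE !mulgA.
  rewrite conjMg !aff_refl_conj d0 dm mulgA r0E -aff_refl0.
  exact: aff_refl3_sq.
- by move=> j jn; apply: cJ; rewrite rE ?aff_refl_conj ?fix0 ?fixm //; lia.
- by move=> j jn; apply: cJ; rewrite rE ?aff_refl_conj ?fix0 ?fixm //; lia.
- by rewrite r0E; apply: (aff_refl_braid _ (k := one)) => //; left.
- by rewrite r0E; apply: (aff_refl_braid _ (k := one)) => //; left.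
- by rewrite rnE; apply: (aff_refl_braid _ (k := pre)) => //; right.
- by rewrite rnE; apply: (aff_refl_braid _ (k := pre)) => //; right.
have dV : (\prod_(j <- downto n 0) (r j)^-1 = \prod_(j <- downto n 0) r j)%g.
  rewrite big_seq [RHS]big_seq; apply: eq_bigr => j.
  by rewrite mem_downto => jn; apply: rV.
rewrite dV -(rho_downto rE') rV; last lia.
have -> : (p^-1 = p)%g by apply: mulg1_eq; apply: aff_refl_sq.
have -> : (q^-1 = q)%g by apply: mulg1_eq; apply: aff_refl_sq.
rewrite (rE n.-1); last lia.
rewrite (rE 0%N); last lia.
set d := (\prod_(j <- downto n 0) adj n j)%g.
set t := adj n n.-1.
pose theta : 'S_n.+1 := tperm ord0 ord_max.
(* c1 and c2 say that the translation parts contributed by p and by q are the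
   same on both sides; the permutations agree by [descending_cycle_relation]. *)
have pe (w : 'S_n.+1) a b x : w a = b -> (w x == b) = (x == a).
  by move=> <-; rewrite (inj_eq perm_inj).
have dm : d ord_max = ord0 by apply: val_inj; rewrite /= descending_cycleE eqxx.
have dpre : d pre = ord_max.
  by apply: val_inj; rewrite /= descending_cycleE preE; case: ifP; lia.
have t0 : t ord0 = ord0.
  by apply: val_inj; rewrite /= adjE /=; do ?case: ifP; lia.
have tpre : t pre = ord_max.
  by apply: val_inj; rewrite /= adjE ?preE ?eqxx /=; lia.
have tm : t ord_max = pre.
  by apply: val_inj; rewrite /= adjE ?preE /=; do ?case: ifP; lia.
have thpre : theta pre = pre by rewrite tpermD.
have c1 x : root_sign ord0 ord_max (d (theta x)) = root_sign ord0 ord_max (t x).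
  rewrite /root_sign (pe _ _ _ _ dm) (pe _ _ _ _ dpre) (pe _ _ _ _ t0) (pe _ _ _ _ tpre).
  by rewrite (pe _ _ _ _ thpre) (pe _ _ _ _ (tpermL ord0 ord_max)).
have c2 x : root_sign ord0 ord_max (d (theta (t x))) = root_sign ord0 ord_max x.
  by rewrite c1 /root_sign (pe _ _ _ _ t0) (pe _ _ _ _ tpre) (pe _ _ _ _ t0) (pe _ _ _ _ tm).
apply: WA_inj => z x; rewrite 6!actM !(permAE, aff_reflE) -!/(root_sign _ _ _) c1 c2.
have := congr1 (fun w : 'S_n.+1 => w x) (descending_cycle_relation n_gt1).
by rewrite !permM => ->; rewrite [LHS]addrAC.
Qed.

Hypothesis alphaP : 0 < complex.Im alpha.

(** A product in normal form is mapped by phi to a translation followed by a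
    permutation; the coordinates of the translation other than the first are, up
    to sign, the lattice elements encoded by the exponents. *)
Lemma WA_reflection_presentation : reflection_presentation (WA n.+1 alpha) (@relsA n.+1).
Proof.
pose g (i : 'I_n.+2) : G := if (i < n)%N then permA (adj n i) else
  if i == n :> nat then p else q.
have gr (j : nat) : (j < n)%N -> g (inord j) = permA (adj n j).
  by move=> jn; rewrite /g inordK ?jn //; lia.
have gp : g (inord n) = p by rewrite /g inordK // ltnn eqxx.
have gq : g (inord n.+1) = q.
  have -> : g (inord n.+1) = if (n.+1 < n)%N then permA (adj n n.+1) else
      if n.+1 == n then p else q by rewrite /g inordK.
  by rewrite ifF ?ifF //; lia.
apply: (presentation_criterion (g := g)).
- apply/satisfies_relsA => //; rewrite gp gq.
  exact: relsA_aff_refl.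
- move=> i; rewrite /g; case: ifP => iN.
    by rewrite -aff_refl0; apply: aff_refl_reflection; apply: adj_neq.
  by case: eqP => _; apply: aff_refl_reflection.
move=> phi phig.
pose P := presented (@relsA n.+1).
have /satisfies_relsA := @pgen_satisfies _ (@relsA n.+1) => /(_ n_gt1) E.
have [rho rhoE] := coxeterA_hom (relsA_cox E).
have phir (j : nat) : (j < n)%N -> phi (rho (adj n j)) = permA (adj n j).
  by move=> jn; rewrite rhoE // phig gr.
have phirho := hom_perm_ext phir.
split=> [x phix|].
  have [] := @affine_symmetric_normal_form _ _ _ _ _ n_gt1 E rho rhoE x.
    apply: presented_mgen_invol => i.
      have := @pgen_satisfies _ (@relsA n.+1) _ _ (@relsA_sq n.+1 i.+1 (ltn_ord i)).
      by rewrite wevalX2 weval_gen weval1 inord_val expg2.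
    have iE k : i = k :> nat -> i = inord k by move=> <-; rewrite inord_val.
    have [/iE ->|i1] := eqVneq (i : nat) n; first by constructor 2.
    have [/iE ->|i2] := eqVneq (i : nat) n.+1; first by constructor 3.
    constructor 1; exists i; first by have := ltn_ord i; lia.
    by congr pgen; apply: iE.
  move=> k [s xE].
  have phi_root w v (vP : in_lattice alpha v) i : phi w = aff_refl ord0 ord_max vP ->
      translates (phi (root_translation w rho i)) (v *: root ord0 i).
    move=> phiw; rewrite /root_translation; have [->|i0] := eqVneq i ord0.
      by rewrite hom1 root_diag scaler0; apply: translates1.
    have -> : phi ((w * rho (tperm ord0 ord_max)) ^ rho (tperm ord_max i))%g =
        (aff_refl ord0 i vP * aff_refl ord0 i (in_lattice0 alpha))%g.
      rewrite homJ gmulfM !phirho phiw -aff_refl0 conjMg !aff_refl_conj.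
      by rewrite tpermL (tpermD max0 i0).
    by rewrite -[X in X *: _]subr0; apply: aff_refl_mul; rewrite eq_sym.
  have trans : translates (phi (\prod_i lattice_word (root_translation (pgen _ (inord n)) rho i)
         (root_translation (pgen _ (inord n.+1)) rho i) (k i))%g)
      (\sum_i ((k i).1%:~R + (k i).2%:~R * alpha) *: root ord0 i).
    rewrite hom_prod; apply: translates_prod => i; rewrite hom_lattice_word.
    by apply: lattice_word_root; [apply: (phi_root _ _ (lattice1 alpha))
      |apply: (phi_root _ _ (lattice_alpha alpha))]; rewrite phig ?gp ?gq.
  have [] := translation_perm_eq1 trans (s := s).
    by rewrite -phirho -gmulfM -xE.
  move=> sum0 s1; rewrite xE s1 hom1 mulg1 big1 // => i _.
  have [->|i0] := eqVneq i ord0.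
    rewrite /root_translation eqxx /lattice_word.
    have expgz1 m : expgz (1%g : P) m = 1%g by case: m => m /=; rewrite expg1n ?invg1.
    by rewrite !expgz1 mulg1.
  suff -> : k i = (0, 0) by rewrite lattice_word0.
  apply: (lattice_independent alphaP).
  have := congr1 (fun w : W => vsval w i 0) sum0.
  rewrite sum_rootE raddf0 [RHS]mxE (negPf i0) mul0r sub0r => /eqP.
  by rewrite oppr_eq0 => /eqP.
apply: WA_generated.
- by exists 1%g; rewrite hom1.
- by move=> _ _ [x <-] [y <-]; exists (x * y)%g; rewrite gmulfM.
- by move=> _ [x <-]; exists x^-1%g; rewrite homV.
- by move=> s; exists (rho s).
- by exists (pgen _ (inord n)); rewrite phig gp.
- by exists (pgen _ (inord n.+1)); rewrite phig gq.
Qed.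

End Relations.

End AffineSymmetricGroup.

(** With two coordinates the space is a line, and the three reflections along
    e_0 - e_1 are inversions of it. *)
Lemma WA_2_reflection_presentation (R : realType) (alpha : R[i]) :
  0 < complex.Im alpha -> reflection_presentation (WA 2 alpha) rels1.
Proof.
move=> alphaP.
have o1 : ord0 != ord_max :> 'I_2 by [].
pose refl v vP := @aff_refl R alpha 1 ord0 ord_max v vP.
pose g (i : 'I_3) : WA 2 alpha := if i == 0%N :> nat then refl 0 (in_lattice0 alpha) else
  if i == 1%N :> nat then refl 1 (lattice1 alpha) else refl alpha (lattice_alpha alpha).
have g0 : g (inord 0) = refl 0 (in_lattice0 alpha) by rewrite /g inordK.
have g1 : g (inord 1) = refl 1 (lattice1 alpha) by rewrite /g inordK.
have g2 : g (inord 2) = refl alpha (lattice_alpha alpha) by rewrite /g inordK.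
apply: (presentation_criterion (g := g)).
- apply/satisfies_rels1; rewrite g0 g1 g2; split; last exact: aff_refl3_sq.
  by move=> i; rewrite /g; do !case: ifP => _; apply: aff_refl_sq.
- by move=> i; rewrite /g; do !case: ifP => _; apply: aff_refl_reflection.
move=> phi phig.
have adjm : adj 1 0 = tperm ord0 ord_max.
  by congr tperm; apply: val_inj; rewrite /= inordK.
split=> [x phix|].
  have [k [e xE]] := presented_rels1_normal_form x.
  have phi_root v (vP : in_lattice alpha v) :
      translates (refl 0 (in_lattice0 alpha) * refl v vP)%g (v *: root R ord_max ord0).
    by have := aff_refl_mul (in_lattice0 alpha) vP o1; rewrite sub0r scaleNr -scalerN opp_root.
  have trans := lattice_word_root k (phi_root _ (lattice1 alpha)) (phi_root _ (lattice_alpha alpha)).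
  have [] := translation_perm_eq1 (isT : (0 < 1)%N) (s := (tperm ord0 ord_max ^+ e)%g) trans.
    rewrite -phix xE gmulfM hom_lattice_word !gmulfM !phig g0 g1 g2; congr (_ * _)%g.
    by case: e {xE}; rewrite ?expg1 ?phig ?g0 -?aff_refl0 // !hom1.
  move=> t0 e0; rewrite xE.
  have -> : k = (0, 0).
    apply: (lattice_independent alphaP).
    have := congr1 (fun w : subvs_of (sum0 R 2) => vsval w ord_max 0) t0.
    by rewrite scale_rootE raddf0 [RHS]mxE eqxx addr0 mulr1.
  rewrite lattice_word0 mul1g; case: e e0 {xE} => // /permP/(_ ord0).
  by rewrite expg1 tpermL perm1.
apply: (@WA_generated _ _ 1 isT).
- by exists 1%g; rewrite hom1.
- by move=> _ _ [x <-] [y <-]; exists (x * y)%g; rewrite gmulfM.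
- by move=> _ [x <-]; exists x^-1%g; rewrite homV.
- pose Pr s := exists x, phi x = @permA R alpha 1 s.
  move=> s; apply: (@tperm_interval_ind 1 0 1 Pr) => [|u w [x xE] [y yE]|j _ j1|i].
  + by exists 1%g; rewrite !hom1.
  + by exists (x * y)%g; rewrite !gmulfM xE yE.
  + have -> : j = 0%N by lia.
    by exists (pgen _ (inord 0)); rewrite phig g0 adjm; apply: aff_refl0.
  + by have := ltn_ord i; lia.
- by exists (pgen _ (inord 1)); rewrite phig g1.
- by exists (pgen _ (inord 2)); rewrite phig g2.
Qed.

(** * The presentations *)

Local Close Scope ring_scope.
Theorem theorem1p6 (R : realType) (alpha : R[i]) (halpha : modular_strip alpha) :
  [/\ [/\ isomorphic (G21 1 alpha) (WA 2 alpha),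
          reflection_presentation (G21 1 alpha) rels1
        & reflection_presentation (WA 2 alpha) rels1],
      (forall n : nat, 2 <= n ->
         reflection_presentation (G21 n alpha) (@relsG n))
    & (forall n : nat, 3 <= n ->
         reflection_presentation (WA n alpha) (@relsA n))].
Proof.
have [alphaP _ _] := halpha.
have presG := G21_1_reflection_presentation alphaP.
have presA := WA_2_reflection_presentation alphaP.
split.
- by split=> //; apply: presentation_isomorphic presG presA.
- by case=> // n n_gt0; apply: G21_reflection_presentation.
- by case=> // n n_gt1; apply: WA_reflection_presentation => //; apply: ltnW.
Qed.
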